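(* Consider the optimization problem, the barrier $b$ and the iterates generated by the algorithm described in the context, under the assumptions stated there, with $\epsilon_{\rm p},\epsilon_{\rm d}>0$. Suppose additionally that $q$ is locally Lipschitz continuous on its domain, assumed to be closed. Then $\inf_{k\in\mathbb{N}}\mu_k>0$ and exactly one of the following scenarios occurs: (A) either the algorithm terminates returning an $(\epsilon_{\rm p},\epsilon_{\rm d})$-KKT stationary point for the problem, (B) or it runs indefinitely with $s_k\le\epsilon_{\rm p}<p_k$ for all $k$ large enough, and $\alpha_k\nearrow\infty$. Moreover, any accumulation point $\bar x$ of $(x^k)$ is KKT-stationary for the feasibility problem of minimizing $\|[c(x)]_+\|_1+\|c^{\rm eq}(x)\|_1$ over $x\in\operatorname{dom}q$, in the sense that $$0\in\partial\bigl[\|[c(\cdot)]_+\|_1+\|c^{\rm eq}(\cdot)\|_1\bigr](\bar x)+N_{\operatorname{dom}q}(\bar x).$$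
   Context: Problem: minimize $q(x)$ over $x\in\mathbb{R}^n$ subject to $c(x)\le 0$, $c^{\rm eq}(x)=0$, where $q:\mathbb{R}^n\to\mathbb{R}\cup\{\pm\infty\}$ is proper and lower semicontinuous, $c:\mathbb{R}^n\to\mathbb{R}^m$ and $c^{\rm eq}:\mathbb{R}^n\to\mathbb{R}^{m_{\rm eq}}$ are continuously differentiable, and the infimum is finite. $\partial$ is the limiting (Mordukhovich) subdifferential, $N_E=\partial\iota_E$ the limiting normal cone of a set $E$ ($\iota_E$ the indicator function), $J$ the Jacobian, $[r]_+=\max\{0,r\}$, $[r]_-=\max\{0,-r\}$ (elementwise on vectors). Approximate KKT points: $\bar x$ is an $(\epsilon_{\rm p},\epsilon_{\rm d})$-KKT (stationary) point if there exist $\bar y\in\mathbb{R}^m$, $\bar y^{\rm eq}\in\mathbb{R}^{m_{\rm eq}}$ with $\operatorname{dist}(-Jc(\bar x)^\top\bar y-Jc^{\rm eq}(\bar x)^\top\bar y^{\rm eq},\partial q(\bar x))\le\epsilon_{\rm d}$, $\|[c(\bar x)]_+\|_\infty\le\epsilon_{\rm p}$, $\|c^{\rm eq}(\bar x)\|_\infty\le\epsilon_{\rm p}$, $\bar y\ge0$, and $\min\{\bar y_i,[c_i(\bar x)]_-\}\le\epsilon_{\rm p}$ for $i=1,\dots,m$. Barrier: $b:\mathbb{R}\to\mathbb{R}\cup\{\pm\infty\}$ is proper, lower semicontinuous, twice continuously differentiable on its domain $\operatorname{dom}b=(-\infty,0)$, with $b'>0$ and $b''>0$ there. $b^*(\tau)=\sup_t\{\tau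 t-b(t)\}$ is its convex conjugate. For $\rho^*>0$: $\psi_{\rho^*}(t)=\min_{z\ge0}\{\rho^*z+b(t-z)\}$, $\psi^{\rm eq}_{\rho^*}(t)=\min_{z\in\mathbb{R}}\{\rho^*z+b(t-z)+b(-t-z)\}$. For $\alpha,\mu>0$: $F_{\alpha,\mu}(x)=q(x)+\mu\sum_{i=1}^m\psi_{\alpha/\mu}(c_i(x))+\mu\sum_{j=1}^{m_{\rm eq}}\psi^{\rm eq}_{\alpha/\mu}(c^{\rm eq}_j(x))$. Algorithm: given $\epsilon_{\rm p},\epsilon_{\rm d}\ge0$, $\alpha_0,\mu_0>0$, $\varepsilon_0\ge\epsilon_{\rm d}$, $\delta_\alpha>1$, $\delta_\varepsilon,\delta_\mu\in(0,1)$, repeat for $k=0,1,\dots$: 1. Find (any) $x^k$ with $\operatorname{dist}(0,\partial F_{\alpha_k,\mu_k}(x^k))\le\varepsilon_k$ (such a point is assumed to exist; distance to $\emptyset$ is $\infty$). 2. Set $y^k_i=\mu_k\psi_{\alpha_k/\mu_k}'(c_i(x^k))$, $i=1,\dots,m$, and $y^{{\rm eq},k}_j=\mu_k(\psi^{\rm eq}_{\alpha_k/\mu_k})'(c^{\rm eq}_j(x^k))$, $j=1,\dots,m_{\rm eq}$. 3. Set $p_k=\max\{\|[c(x^k)]_+\|_\infty,\|c^{\rm eq}(x^k)\|_\infty\}$. 4. Let $s_k$ be the maximum absolute value, over all $i=1,\dots,m$ and $j=1,\dots,m_{\rm eq}$, of the quantities $\min\{y^k_i,[c_i(x^k)]_-\}$,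 $\min\{\alpha_k-y^k_i,[c_i(x^k)]_+\}$, $\min\{\alpha_k+y^{{\rm eq},k}_j,[c^{\rm eq}_j(x^k)]_-\}$, $\min\{\alpha_k-y^{{\rm eq},k}_j,[c^{\rm eq}_j(x^k)]_+\}$. 5. If $\varepsilon_k\le\epsilon_{\rm d}$, $p_k\le\epsilon_{\rm p}$ and $s_k\le\epsilon_{\rm p}$, stop and return $(x^k,y^k)$. 6. Set $\varepsilon_{k+1}=\max\{\delta_\varepsilon\varepsilon_k,\epsilon_{\rm d}\}$. 7. If $p_k>\max\bigl\{\epsilon_{\rm p},\,2(m+m_{\rm eq})\frac{-b^*(\alpha_k/\mu_k)}{\alpha_k/\mu_k}\bigr\}$ set $\alpha_{k+1}=\delta_\alpha\alpha_k$, else $\alpha_{k+1}=\alpha_k$. 8. If $s_k>\epsilon_{\rm p}$ or $\alpha_{k+1}=\alpha_k$ set $\mu_{k+1}=\delta_\mu\mu_k$, else $\mu_{k+1}=\mu_k$. *)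

(* Defs.v *)
Set Warnings "-notation-overridden,-notation-incompatible-prefix,-ambiguous-paths".
From mathcomp Require Export all_boot all_order all_algebra.
From mathcomp Require Export all_classical all_reals all_analysis.
Export Order.TTheory GRing.Theory Num.Theory.
Export numFieldNormedType.Exports.

Set Implicit Arguments.
Unset Strict Implicit.
Unset Printing Implicit Defensive.

Global Open Scope classical_set_scope.
Global Open Scope ring_scope.

(* Vectors of R^n are row vectors. MathComp-Analysis' norm `|u| on 'rV[R]_n is
   the sup norm; it induces the usual topology, but distances to
   subdifferentials are Euclidean, hence [l2norm]. *)

Section Vectors.
Variable R : realType.

Definition pos_part (r : R) : R := Num.max 0 r.
Definition neg_part (r : R) : R := Num.max 0 (- r).

Definition dotv n (u v : 'rV[R]_n) : R := \sum_i u 0 i * v 0 i.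
Definition l2norm n (u : 'rV[R]_n) : R := Num.sqrt (dotv u u).
Definition l1norm n (u : 'rV[R]_n) : R := \sum_i `|u 0 i|.
Definition posv n (u : 'rV[R]_n) : 'rV[R]_n := map_mx pos_part u.

Definition dist n (v : 'rV[R]_n) (A : set 'rV[R]_n) : \bar R :=
  ereal_inf [set (l2norm (v - w))%:E | w in A].

Definition C1 n m (f : 'rV[R]_n -> 'rV[R]_m) : Prop :=
  (forall x, differentiable f x) /\ continuous (jacobian f).

(* The library's [jacobian f x] acts on row vectors from the right, so that it
   is the transpose of the usual Jacobian; [JacT f x y] is the row vector
   Jf(x)^T y. *)
Definition JacT n m (f : 'rV[R]_n -> 'rV[R]_m) (x : 'rV[R]_n) (y : 'rV[R]_m) :
  'rV[R]_n := y *m (jacobian f x)^T.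

End Vectors.

Section VariationalAnalysis.
Variables (R : realType).
Local Open Scope ereal_scope.

Definition edom (T : Type) (f : T -> \bar R) : set T := [set x | f x < +oo].

Definition proper_fun (T : Type) (f : T -> \bar R) : Prop :=
  (exists x, f x < +oo) /\ (forall x, -oo < f x).

Variable n : nat.
Implicit Types (f : 'rV[R]_n -> \bar R) (x : 'rV[R]_n) (E : set 'rV[R]_n).

(* f(y) >= f(x) + <v, y - x> + o(|y - x|) as y -> x *)
Definition regular_subdiff f x : set 'rV[R]_n :=
  [set v | f x \is a fin_num /\
     forall e : R, (0 < e)%R -> \forall y \near x,
       f x + (dotv v (y - x) - e * l2norm (y - x))%R%:E <= f y].

Definition limiting_subdiff f x : set 'rV[R]_n :=
  [set v | f x \is a fin_num /\
     exists xs vs : nat -> 'rV[R]_n,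
       [/\ xs @ \oo --> x,
           (fun k => f (xs k)) @ \oo --> f x,
           vs @ \oo --> v &
           forall k, regular_subdiff f (xs k) (vs k)]].

Definition indicator_fun E x : \bar R := if x \in E then 0 else +oo.

Definition normal_cone E x : set 'rV[R]_n :=
  limiting_subdiff (indicator_fun E) x.

Definition locally_lipschitz_on_dom f : Prop :=
  forall x, edom f x ->
    exists2 U, nbhs x U & [lipschitz (fine (f y) : R^o) | y in U `&` edom f].

End VariationalAnalysis.

Section Barrier.
Variable R : realType.
Implicit Types (b : R -> \bar R) (rho t : R).
Local Open Scope ereal_scope.

Record barrier b : Prop := Barrier {
  barrier_proper : proper_fun b ;
  barrier_lsc : lower_semicontinuous b ;
  barrier_dom : edom b = [set t | (t < 0)%R] ;
  barrier_C2 : forall t, (t < 0)%R ->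
    [/\ derivable (fine \o b) t 1,
        derivable (derive1 (fine \o b)) t 1 &
        {for t, continuous (derive1 (derive1 (fine \o b)))}] ;
  barrier_incr : forall t, (t < 0)%R -> (0 < derive1 (fine \o b) t)%R ;
  barrier_conv : forall t, (t < 0)%R ->
    (0 < derive1 (derive1 (fine \o b)) t)%R
}.

Definition econj b (tau : R) : \bar R :=
  ereal_sup [set (tau * t)%R%:E - b t | t in setT].

(* The minima defining the marginalized penalties are written as infima, with
   which they coincide whenever they are attained. *)
Definition psi b rho t : \bar R :=
  ereal_inf [set (rho * z)%R%:E + b (t - z)%R | z in [set z : R | (0 <= z)%R]].

Definition psieq b rho t : \bar R :=
  ereal_inf [set (rho * z)%R%:E + b (t - z)%R + b (- t - z)%R | z in setT].

End Barrier.

Section Problem.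
Variables (R : realType) (n m meq : nat).
Variables (q : 'rV[R]_n -> \bar R) (c : 'rV[R]_n -> 'rV[R]_m)
  (ceq : 'rV[R]_n -> 'rV[R]_meq).

Definition feasible : set 'rV[R]_n :=
  [set x | (forall i, c x 0 i <= 0) /\ ceq x = 0].

Definition KKT_point (ep ed : R) (x : 'rV[R]_n) : Prop :=
  exists (y : 'rV[R]_m) (yeq : 'rV[R]_meq),
    [/\ (dist (- JacT c x y - JacT ceq x yeq) (limiting_subdiff q x)
           <= ed%:E)%E,
        `|posv (c x)| <= ep,
        `|ceq x| <= ep,
        forall i, 0 <= y 0 i &
        forall i, Num.min (y 0 i) (neg_part (c x 0 i)) <= ep].

Definition infeasibility (x : 'rV[R]_n) : \bar R :=
  (l1norm (posv (c x)) + l1norm (ceq x))%:E.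

Definition KKT_feasibility_problem (x : 'rV[R]_n) : Prop :=
  [set u + v | u in limiting_subdiff infeasibility x &
               v in normal_cone (edom q) x] 0.

End Problem.

Record algo_params (R : realType) := AlgoParams {
  eps_p : R ; eps_d : R ;
  alpha0 : R ; mu0 : R ; epsilon0 : R ;
  delta_alpha : R ; delta_eps : R ; delta_mu : R
}.

Record algo_params_ok (R : realType) (P : algo_params R) : Prop :=
  AlgoParamsOk {
    eps_p_gt0 : 0 < eps_p P ;
    eps_d_gt0 : 0 < eps_d P ;
    alpha0_gt0 : 0 < alpha0 P ;
    mu0_gt0 : 0 < mu0 P ;
    epsilon0_ge : eps_d P <= epsilon0 P ;
    delta_alpha_gt1 : 1 < delta_alpha P ;
    delta_eps_itv : 0 < delta_eps P < 1 ;
    delta_mu_itv : 0 < delta_mu P < 1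
  }.

Section Algorithm.
Variables (R : realType) (n m meq : nat).
Variables (b : R -> \bar R) (q : 'rV[R]_n -> \bar R)
  (c : 'rV[R]_n -> 'rV[R]_m) (ceq : 'rV[R]_n -> 'rV[R]_meq).

Definition subproblem_obj (a mu : R) (x : 'rV[R]_n) : \bar R :=
  (q x + mu%:E * (\sum_(i < m) psi b (a / mu) (c x 0%R i))
       + mu%:E * (\sum_(j < meq) psieq b (a / mu) (ceq x 0%R j)))%E.

Definition mult (a mu : R) (x : 'rV[R]_n) (i : 'I_m) : R :=
  mu * derive1 (fine \o psi b (a / mu)) (c x 0 i).

Definition multeq (a mu : R) (x : 'rV[R]_n) (j : 'I_meq) : R :=
  mu * derive1 (fine \o psieq b (a / mu)) (ceq x 0 j).

Definition pres (x : 'rV[R]_n) : R := Num.max `|posv (c x)| `|ceq x|.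

Definition sres (a mu : R) (x : 'rV[R]_n) : R :=
  Num.max
    (\big[Num.max/0]_(i < m)
       Num.max `|Num.min (mult a mu x i) (neg_part (c x 0 i))|
               `|Num.min (a - mult a mu x i) (pos_part (c x 0 i))|)
    (\big[Num.max/0]_(j < meq)
       Num.max `|Num.min (a + multeq a mu x j) (neg_part (ceq x 0 j))|
               `|Num.min (a - multeq a mu x j) (pos_part (ceq x 0 j))|).

(* extended real, since the conjugate of b may take the value +oo *)
Definition penalty_threshold (P : algo_params R) (a mu : R) : \bar R :=
  maxe (eps_p P)%:E
    ((2 * (m + meq))%N%:R%:E * (- econj b (a / mu) * ((a / mu)^-1)%:E))%E.

Variables (P : algo_params R) (x : nat -> 'rV[R]_n) (alpha mu eps : nat -> R).

Definition stops (k : nat) : Prop :=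
  [/\ eps k <= eps_d P, pres (x k) <= eps_p P
    & sres (alpha k) (mu k) (x k) <= eps_p P].

(* iteration k is performed; the sequences are unconstrained at the indices
   beyond termination *)
Definition reached (k : nat) : Prop := forall j, (j < k)%N -> ~ stops j.

Record algo_run : Prop := AlgoRun {
  run_alpha0 : alpha 0%N = alpha0 P ;
  run_mu0 : mu 0%N = mu0 P ;
  run_eps0 : eps 0%N = epsilon0 P ;
  run_x : forall k, reached k ->
    (dist 0 (limiting_subdiff (subproblem_obj (alpha k) (mu k)) (x k))
       <= (eps k)%:E)%E ;
  run_eps : forall k, reached k.+1 ->
    eps k.+1 = Num.max (delta_eps P * eps k) (eps_d P) ;
  run_alpha : forall k, reached k.+1 ->
    alpha k.+1 =
      if (penalty_threshold P (alpha k) (mu k) < (pres (x k))%:E)%E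
      then delta_alpha P * alpha k else alpha k ;
  run_mu : forall k, reached k.+1 ->
    mu k.+1 =
      if (eps_p P < sres (alpha k) (mu k) (x k)) || (alpha k.+1 == alpha k)
      then delta_mu P * mu k else mu k
}.

Definition returns_KKT : Prop :=
  exists k, [/\ reached k, stops k &
                KKT_point q c ceq (eps_p P) (eps_d P) (x k)].

Definition runs_indefinitely_infeasible : Prop :=
  [/\ forall k, ~ stops k,
      \forall k \near \oo,
        sres (alpha k) (mu k) (x k) <= eps_p P < pres (x k),
      nondecreasing_seq alpha /\ alpha @ \oo --> +oo &
      forall xbar, cluster (x @ \oo) xbar ->
        KKT_feasibility_problem q c ceq xbar].

End Algorithm.

(* Main.v *)
Require Import Defs.
From mathcomp Require Import ring lra.

Set Implicit Arguments.
Unset Strict Implicit.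
Unset Printing Implicit Defensive.

(* The marginalized penalties psi and psi^eq are convex and C^1, with 0 <= psi' <= rho and
   psi'(t) <= b'(t) for t < 0, and similarly for psi^eq. Hence a stationary point of the
   subproblem satisfies the approximate KKT conditions as soon as the residuals are small.

   Along an infinite run alpha / mu grows geometrically, so the feasibility threshold
   drops below eps_p, and a small mu forces the complementarity residual below eps_p; mu is
   therefore decreased finitely often only, and afterwards alpha is increased at every
   step.

   At an accumulation point, divide the stationarity conditions by alpha -> oo. The scaled
   multipliers converge, along a subsequence, to a subgradient of the infeasibility
   measure. Since q is Lipschitz on its domain, a subgradient of q divided by alpha is an
   O(1/alpha)-approximate normal to dom q; projecting on the closed set dom q turns it into
   a nearby exact normal, so that the limit lies in the limiting normal cone. *)

(** * Barrier and marginalized penalties *)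

(** Regularity of the penalties is delicate because the infima defining them may be unattained or
    even equal to -oo when rho lies below all slopes of [b] (or, for psi^eq, below twice these
    slopes). Finiteness comes from the stationarity test: a subgradient exists only where the
    objective is finite, and one finite value of psi makes it finite and smooth everywhere.
    Differentiability comes from a squeeze: freezing a minimizer gives a smooth function touching
    psi from above, whose tangent is a global minorant.

    Limiting subgradients are limits of regular ones taken at other points. The asymptotic part
    therefore works at points z_k near x^k, with subgradients of norm at most epsilon0 + 2;
    boundedness suffices since they are divided by alpha. The slope bounds psi' <= alpha / mu and
    |psi^eq'| <= alpha / mu keep the scaled multipliers in a compact set. An approximate normal has
    to be replaced by an exact one because limiting normals are limits of exact regular normals. *)

Section ConvexDerivative.
Variable R : realType.
Implicit Types (f h : R -> R) (s t D e : R).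

(** Without a quotient the point s = t is no exception, and derivatives can be read off from
    inequalities. *)
Lemma is_derive1P f t D :
  is_derive t 1 f D <->
  forall e, 0 < e -> \forall s \near t, `|f s - f t - D * (s - t)| <= e * `|s - t|.
Proof.
have key : (h^-1 *: ((f \o shift t) (h *: 1) - f t) @[h --> 0^'] --> D) <->
    forall e, 0 < e ->
      \forall s \near t, `|f s - f t - D * (s - t)| <= e * `|s - t|.
  split=> [/cvgrPdist_le fD e e0|fD].
    move: (fD e e0); rewrite /dnbhs /within /= => /nbhs_normP[r /= r0 Hr].
    apply/nbhs_normP; exists r => //= s; rewrite /ball_ /= distrC => str.
    have [->|nst] := eqVneq s t; first by rewrite !subrr mulr0 subrr !normr0 mulr0.
    have st0 : s - t != 0 by rewrite subr_eq0.
    have := Hr (s - t); rewrite /ball_ /= sub0r normrN => /(_ str st0).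
    rewrite scaler1 subrK /GRing.scale /= => H.
    have -> : f s - f t - D * (s - t) =
      - ((D - (s - t)^-1 * (f s - f t)) * (s - t)) by field.
    by rewrite normrN normrM; apply: ler_wpM2r.
  apply/cvgrPdist_le => e e0; rewrite /dnbhs /within /=.
  have /nbhs_normP[r /= r0 Hr] := fD e e0.
  apply/nbhs_normP; exists r => //= h; rewrite /ball_ /= sub0r normrN => hr h0.
  have := Hr (h + t); rewrite /ball_ /= opprD addrCA subrr addr0 normrN => /(_ hr).
  rewrite addrK scaler1 /GRing.scale /= => H.
  have -> : D - h^-1 * (f (h + t) - f t) = - ((f (h + t) - f t - D * h) * h^-1).
    by field.
  by rewrite normrN normrM normfV ler_pdivrMr // normr_gt0.
rewrite -key; split=> [[df <-]|fD]; first exact: df.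
by split; [apply/cvg_ex; exists D|apply: cvg_lim].
Qed.

(** The remainder of [f] at [t] is nonnegative and at most that of [h]. *)
Lemma derive_squeeze f h t D : is_derive t 1 h D -> h t = f t ->
  (forall s, f t + D * (s - t) <= f s) -> (\forall s \near t, f s <= h s) ->
  is_derive t 1 f D.
Proof.
move=> /is_derive1P hD ht fge fle; apply/is_derive1P => e e0.
near=> s.
have A : f s <= h s by near: s.
have : `|h s - h t - D * (s - t)| <= e * `|s - t| by near: s; apply: hD.
have := fge s; rewrite ht => B /(le_trans (ler_norm _)) C.
by rewrite ger0_norm; lra.
Unshelve. all: by end_near. Qed.

(** The tangent at s, tested at s + r/4 and s - r/4, bounds f'(s) on both sides by difference
    quotients of [f], which the expansion at t compares with f'(t). *)
Lemma subgradient_continuous f f' : (forall t, is_derive t 1 f (f' t)) ->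
  (forall s t, f t + f' t * (s - t) <= f s) -> continuous f'.
Proof.
move=> df fge t; apply/cvgrPdist_le => /= e e0.
(* The errors e/3 * r/2 at the test point and e/3 * r/4 at s add up to e * r/4, that is e times the
   step. *)
have e3 : 0 < e / 3 by lra.
have /is_derive1P/(_ _ e3)/nbhs_normP[r /= r0 Hr] := df t.
apply/nbhs_normP; exists (r / 4); first by rewrite /=; lra.
move=> s; rewrite /ball_ /= distrC => str.
have near p : `|p - s| <= r / 4 -> `|f p - f t - f' t * (p - t)| <= e / 3 * (r / 2).
  move=> ps; have pt : `|p - t| <= r / 2.
    by have := ler_normD (p - s) (s - t); rewrite subrKA; lra.
  apply: le_trans (_ : e / 3 * `|p - t| <= _); last by apply: ler_wpM2l => //; lra.
  by apply: Hr; rewrite /ball_ /= distrC; lra.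
have ns : `|f s - f t - f' t * (s - t)| <= e / 3 * (r / 4).
  apply: le_trans (_ : e / 3 * `|s - t| <= _); last by apply: ler_wpM2l => //; lra.
  by apply: Hr; rewrite /ball_ /= distrC; lra.
have r4 : `|r / 4| = r / 4 by rewrite ger0_norm//; lra.
have np := near (s + r / 4); have nm := near (s - r / 4).
rewrite addrAC subrr add0r ?normrN r4 in np.
rewrite addrAC subrr add0r ?normrN r4 in nm.
move: (np (lexx _)) (nm (lexx _)) ns; rewrite !ler_norml.
move=> /andP[P1 P2] /andP[M1 M2] /andP[N1 N2].
have := fge (s + r / 4) s; have := fge (s - r / 4) s.
move=> Q1 Q2.
apply/andP; split; rewrite -subr_ge0 -(pmulr_lge0 _ r0); nra.
Qed.

Lemma is_derive1_comp_affine f (g : R -> R) k t D :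
  (forall s, g s = g t + k * (s - t)) ->
  is_derive (g t) 1 f D -> is_derive t 1 (fun s => f (g s)) (D * k).
Proof.
move=> gE df; have dg : is_derive t 1 g k.
  apply/is_derive1P => e e0; near=> s.
  by rewrite gE (_ : _ - _ = 0) ?normr0 ?mulr_ge0 ?(ltW e0)//; ring.
exact: is_derive1_comp dg.
Unshelve. all: by end_near. Qed.

End ConvexDerivative.

(** * Monotonicity, convexity and blow-up of the barrier *)

Section BarrierDerivative.
Variables (R : realType) (b : R -> \bar R).
Hypothesis bar : barrier b.
Implicit Types s t : R.

Local Notation B := (fine \o b).
Local Notation d := (derive1 B).

Lemma barrierE t : t < 0 -> b t = (B t)%:E.
Proof.
move=> t0; rewrite /= fineK// fin_numElt (barrier_proper bar).2 /=.
by have : edom b t by rewrite (barrier_dom bar).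
Qed.

Lemma barrier_pinfty t : 0 <= t -> b t = +oo%E.
Proof.
move=> t0; apply/eqP; rewrite eq_le leey leNgt; apply/negP => bt.
have : edom b t by [].
by rewrite (barrier_dom bar) /= ltNge t0.
Qed.

Lemma barrier_neq_ninfty t : b t != -oo%E.
Proof. by have := (barrier_proper bar).2 t; rewrite lt_neqAle eq_sym => /andP[]. Qed.

Lemma barrier_is_derive t : t < 0 -> is_derive t 1 B (d t).
Proof.
by move=> t0; have [db _ _] := barrier_C2 bar t0; rewrite derive1E; apply: derivableP.
Qed.

Lemma barrier_derivable2 t : t < 0 -> is_derive t 1 d (derive1 d t).
Proof.
move=> t0; have [_ db _] := barrier_C2 bar t0.
by rewrite [in X in is_derive _ _ _ X]derive1E; apply: derivableP.
Qed.

Lemma barrier_derive_continuous s t : t < 0 -> {within `[s, t], continuous d}.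
Proof.
move=> t0; apply: derivable_within_continuous => u; rewrite in_itv /= => /andP[_ ut].
by have [_ db _] := barrier_C2 bar (le_lt_trans ut t0).
Qed.

Lemma barrier_continuous s t : t < 0 -> {within `[s, t], continuous B}.
Proof.
move=> t0; apply: derivable_within_continuous => u; rewrite in_itv /= => /andP[_ ut].
by have [db _ _] := barrier_C2 bar (le_lt_trans ut t0).
Qed.

Lemma barrier_derive_lt s t : s < t -> t < 0 -> d s < d t.
Proof.
move=> st t0.
have [||u] := @MVT _ d (derive1 d) s t st.
- move=> u; rewrite in_itv /= => /andP[_ ut]; apply: barrier_derivable2.
  exact: lt_trans t0.
- exact: barrier_derive_continuous.
rewrite in_itv /= => /andP[_ ut] E.
by rewrite -subr_gt0 E mulr_gt0 ?subr_gt0// (barrier_conv bar)// (lt_trans ut).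
Qed.

Lemma barrier_derive_le s t : s <= t -> t < 0 -> d s <= d t.
Proof.
by rewrite le_eqVlt => /predU1P[->//|st] t0; apply/ltW/barrier_derive_lt.
Qed.

Lemma barrier_tangent s t : s < 0 -> t < 0 -> B t + d t * (s - t) <= B s.
Proof.
move=> s0 t0; have [ts|st|->] := ltgtP t s; last by rewrite subrr mulr0 addr0.
- have [||u] := @MVT _ B d t s ts.
  + move=> u; rewrite in_itv /= => /andP[_ us]; apply: barrier_is_derive.
    exact: lt_trans s0.
  + exact: barrier_continuous.
  rewrite in_itv /= => /andP[tu us] E.
  have := barrier_derive_lt tu (lt_trans us s0); nra.
- have [||u] := @MVT _ B d s t st.
  + move=> u; rewrite in_itv /= => /andP[_ us]; apply: barrier_is_derive.
    exact: lt_trans t0.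
  + exact: barrier_continuous.
  rewrite in_itv /= => /andP[tu us] E.
  have := barrier_derive_lt us t0; nra.
Qed.

(** If b' <= M, the tangent at t in [-1, 0), tested at -1, gives b(t) <= b(-1) + |M|. This
    contradicts lower semicontinuity at 0, where [b] is +oo. *)
Lemma barrier_derive_unbounded (M : R) : exists2 t, t < 0 & M < d t.
Proof.
apply: contrapT => H.
have dM t : t < 0 -> d t <= M.
  by move=> t0; rewrite leNgt; apply/negP => Mt; apply: H; exists t.
have b0 : (((B (-1) + `|M|)%R)%:E < b 0)%E by rewrite barrier_pinfty ?ltry.
have [V /nbhs_normP[r /= r0 rV] HV] := barrier_lsc bar b0.
pose t : R := - Num.min (r / 2) 1.
have t01 : -1 <= t < 0.
  by rewrite /t lerN2 oppr_lt0 ge_min lexx orbT lt_min ltr01 andbT; lra.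
have tr : `|t| < r.
  rewrite /t normrN ger0_norm; last by rewrite le_min ler01 andbT; lra.
  by rewrite gt_min; apply/orP; left; lra.
have := HV t (rV t _); rewrite /ball_ /= sub0r normrN => /(_ tr).
move: t01 => /andP[t1 t0].
rewrite (barrierE t0) lte_fin.
have N10 : (-1 : R) < 0 by rewrite ltrN10.
move: (barrier_tangent N10 t0) (dM t t0) (barrier_incr bar t0) => /=.
move: (derive1 _ t) (fine (b t)) (fine (b (-1))) => dt Bt B1.
have := ler_norm M; have := normr_ge0 M; move: `|M| => M'.
clear -t0 t1; nra.
Qed.

End BarrierDerivative.

Section SmoothConvex.
Variable R : realType.
Implicit Types (phi : R -> \bar R) (h D : R -> R) (s t : R).

Record smooth_convex phi : Prop := SmoothConvex {
  smooth_fin : forall t, phi t \is a fin_num ;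
  smooth_is_derive : forall t,
    is_derive t 1 (fine \o phi) (derive1 (fine \o phi) t) ;
  smooth_tangent : forall s t,
    fine (phi t) + derive1 (fine \o phi) t * (s - t) <= fine (phi s)
}.

Lemma smooth_derive_continuous phi :
  smooth_convex phi -> continuous (derive1 (fine \o phi)).
Proof.
move=> sc; apply: (@subgradient_continuous _ (fine \o phi)).
  exact: smooth_is_derive.
exact: smooth_tangent.
Qed.

(** For an infimum over z, [h] is the objective with z frozen at a minimizer for [t]: an upper bound
    near [t], exact at [t], whose tangent is a global minorant. This takes the place of
    differentiating the minimizer. *)
Lemma smooth_convex_touching phi D :
  (forall t, exists h, [/\ is_derive t 1 h (D t), phi t = (h t)%:E,
     forall s, ((h t + D t * (s - t))%:E <= phi s)%E &
     \forall s \near t, (phi s <= (h s)%:E)%E]) ->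
  smooth_convex phi /\ derive1 (fine \o phi) =1 D.
Proof.
move=> H.
have fphi t : phi t \is a fin_num by have [h [_ ->]] := H t.
have dphi t : is_derive t 1 (fine \o phi) (D t).
  have [h [dh phit hle hge]] := H t.
  have hphi : h t = (fine \o phi) t by rewrite /= phit.
  apply: (derive_squeeze dh hphi).
    by move=> s; rewrite -hphi -lee_fin /= fineK.
  by apply: filterS hge => s; rewrite -lee_fin /= fineK.
have dE : derive1 (fine \o phi) =1 D.
  by move=> t; rewrite derive1E; apply: derive_val.
split=> //; split=> // t; first by rewrite dE.
move=> s; rewrite dE -lee_fin fineK//.
by have [h [_ -> /(_ t)]] := H s.
Qed.

End SmoothConvex.

(** * Smoothness and slope bounds of the marginalized penalties *)

Section MarginalPenalties.
Variables (R : realType) (b : R -> \bar R).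
Hypothesis bar : barrier b.
Implicit Types (rho s t u w z : R).

Local Notation B := (fine \o b).
Local Notation d := (derive1 B).

Lemma psi_le rho s u : u < 0 -> u <= s ->
  (psi b rho s <= (B u + rho * (s - u))%:E)%E.
Proof.
move=> u0 us; apply: ereal_inf_lbound; exists (s - u); first by rewrite /= subr_ge0.
by rewrite subKr (barrierE bar u0) -EFinD addrC.
Qed.

(** With w = t - z, the hypotheses are the optimality conditions for minimizing over z >= 0 at [t].
    The tangent of [b] at [w] turns them into an affine minorant of slope b'(w). *)
Lemma psi_ge rho t w s : w < 0 -> w <= t -> d w <= rho ->
  (rho - d w) * (t - w) = 0 ->
  ((B w + rho * (t - w) + d w * (s - t))%:E <= psi b rho s)%E.
Proof.
move=> w0 wt dw compl; apply: le_ereal_inf_tmp => _ [z /= z0 <-].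
have [sz|sz] := ltP (s - z) 0; last by rewrite (barrier_pinfty bar sz) addeC leey.
rewrite (barrierE bar sz) -EFinD lee_fin.
by have /= := barrier_tangent bar sz w0; nra.
Qed.

Lemma barrier_derive_surj rho : (exists2 s, s < 0 & d s < rho) ->
  exists2 t, t < 0 & d t = rho.
Proof.
move=> [s s0 sr]; have [t t0 rt] := barrier_derive_unbounded bar rho.
have st : s < t.
  rewrite ltNge; apply/negP => ts.
  by have := barrier_derive_le bar ts s0; rewrite leNgt (lt_trans sr rt).
have [||u] := @IVT _ d s t rho (ltW st).
- exact: (barrier_derive_continuous bar).
- by rewrite ge_min (ltW sr) le_max (ltW rt) orbT.
rewrite in_itv /= => /andP[_ ut] du; exists u => //.
exact: le_lt_trans t0.
Qed.

(* For small [rho] the infimum defining [psi] need not be attained; it is then a limit as z -> oo. *)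
Lemma psi_affine rho : (forall s, s < 0 -> rho <= d s) -> forall t,
  psi b rho t = ((rho * t)%:E +
    ereal_inf [set (B s - rho * s)%:E | s in [set s : R | (s < 0)%R]])%E.
Proof.
move=> rd t; apply/eqP; rewrite eq_le; apply/andP; split.
  rewrite addeC -leeBlDr//; apply: le_ereal_inf_tmp => _ [s s0 <-].
  rewrite leeBlDr// -EFinD.
  have [st|ts] := leP s t.
    by apply: le_trans (psi_le rho s0 st) _; rewrite lee_fin /=; lra.
  apply: le_trans (psi_le rho (lt_trans ts s0) (lexx t)) _; rewrite lee_fin.
  have t0 := lt_trans ts s0.
  by have /= := barrier_tangent bar s0 t0; have := rd t t0; nra.
apply: le_ereal_inf_tmp => _ [z /= z0 <-].
have [tz|tz] := ltP (t - z) 0; last by rewrite (barrier_pinfty bar tz) [leRHS]addeC leey.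
rewrite (barrierE bar tz) addeC -leeBrDr//; apply: ereal_inf_lbound.
exists (t - z) => //.
by rewrite -!EFinD; congr EFin => /=; ring.
Qed.

(** If rho <= b' everywhere, psi is affine of slope rho, and its value at [t0] makes the constant
    finite. Otherwise b'(v) = rho for some v < 0, and psi is [b] up to v, continued by its tangent
    at v; the minimizing z at t is t - min(t, v). *)
Lemma psi_smooth rho t0 : psi b rho t0 \is a fin_num ->
  let D := derive1 (fine \o psi b rho) in
  smooth_convex (psi b rho) /\ forall t,
  [/\ (0 < rho -> 0 <= D t), D t <= rho, (0 <= t -> D t = rho) & (t < 0 -> D t <= d t)].
Proof.
move=> fin; have [[s s0 ds]|nd] := pselect (exists2 s, s < 0 & d s < rho); last first.
  have {}nd s : s < 0 -> rho <= d s.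
    by move=> s0; rewrite leNgt; apply/negP => ds; apply: nd; exists s.
  have /= psiE := psi_affine nd.
  move: fin; rewrite psiE fin_numD /= => Cfin; set C := ereal_inf _ in Cfin psiE.
  have psiE' t : psi b rho t = (rho * t + fine C)%:E.
    by rewrite psiE EFinD fineK.
  have [t|sc DE] := @smooth_convex_touching _ (psi b rho) (fun=> rho).
    exists (fun s => rho * s + fine C); split.
    - apply: is_derive_eq (_ : rho *: 1 + 0 = rho).
      by rewrite addr0 /GRing.scale /= mulr1.
    - exact: psiE'.
    - by move=> s; rewrite psiE' lee_fin; lra.
    - by near=> s; rewrite psiE'.
  split=> // t; rewrite DE; split=> //; first exact: ltW.
  exact: nd.
have [v v0 dv] := barrier_derive_surj (ex_intro2 _ _ s s0 ds).
pose w t := Num.min t v.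
have w0 t : w t < 0 by rewrite gt_min v0 orbT.
have wt t : w t <= t by rewrite ge_min lexx.
have dw t : d (w t) <= rho.
  by rewrite -dv; apply: barrier_derive_le; rewrite // ge_min lexx orbT.
have compl t : (rho - d (w t)) * (t - w t) = 0.
  by rewrite /w; case: ltP => _; rewrite ?subrr ?mulr0// dv subrr mul0r.
have psiE t : psi b rho t = (B (w t) + rho * (t - w t))%:E.
  apply/eqP; rewrite eq_le psi_le//=.
  by have := psi_ge t (w0 t) (wt t) (dw t) (compl t); rewrite subrr mulr0 addr0.
have [t|sc DE] := @smooth_convex_touching _ (psi b rho) (d \o w).
  have [tv|vt] := leP t v.
    have wE : w t = t by rewrite /w min_l.
    have t0' : t < 0 by rewrite -wE.
    exists B; split.
    - rewrite /= wE; exact: (barrier_is_derive bar).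
    - by rewrite psiE wE subrr mulr0 addr0.
    - move=> s'; have := psi_ge s' (w0 t) (wt t) (dw t) (compl t).
      by rewrite wE subrr mulr0 addr0 /= wE.
    - near=> s'; have s'0 : s' < 0 by near: s'; exact: lt_nbhsl.
      by have := psi_le rho s'0 (lexx s'); rewrite subrr mulr0 addr0.
  have wE : w t = v by rewrite /w min_r // ltW.
  exists (fun s => B v + rho * (s - v)); split.
  - rewrite [X in is_derive _ _ _ X]/= wE dv.
    apply: is_derive_eq (_ : 0 + rho *: (1 - 0) = rho).
    by rewrite add0r subr0 /GRing.scale /= mulr1.
  - by rewrite psiE wE.
  - move=> s'; have := psi_ge s' (w0 t) (wt t) (dw t) (compl t).
    by rewrite wE /= wE.
  - near=> s'; apply: psi_le => //; apply/ltW; near: s'; exact: lt_nbhsr.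
split=> // t; rewrite DE; split=> //.
- by move=> _; apply/ltW/(barrier_incr bar).
- exact: dw.
- by move=> t0'; rewrite /= /w min_r ?dv// (le_trans (ltW v0)).
- by move=> tn; apply: barrier_derive_le.
Unshelve. all: by end_near. Qed.

Lemma psieq_le rho s z : `|s| < z ->
  (psieq b rho s <= (rho * z + B (s - z) + B (- s - z))%:E)%E.
Proof.
rewrite ltr_norml => /andP[s1 s2]; apply: ereal_inf_lbound; exists z => //.
by rewrite !(barrierE bar)//; lra.
Qed.

(** The second hypothesis is stationarity in z. Adding the tangents of [b] at both arguments, the
    shift y of any competitor cancels against rho * y, and the slope in [s] is the difference of the
    two derivatives. *)
Lemma psieq_ge rho t z s : `|t| < z -> d (t - z) + d (- t - z) = rho ->
  ((rho * z + B (t - z) + B (- t - z) + (d (t - z) - d (- t - z)) * (s - t))%:E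
    <= psieq b rho s)%E.
Proof.
rewrite ltr_norml => /andP[t1 t2] dz.
have tz1 : t - z < 0 by lra.
have tz2 : - t - z < 0 by lra.
apply: le_ereal_inf_tmp => _ [y _ <-].
have [sy1|sy1] := ltP (s - y) 0; last first.
  by rewrite (barrier_pinfty bar sy1) addey// addye ?leey ?(barrier_neq_ninfty bar).
have [sy2|sy2] := ltP (- s - y) 0; last first.
  by rewrite (barrier_pinfty bar sy2) (barrierE bar sy1) -EFinD addey// leey.
rewrite !(barrierE bar)// -!EFinD lee_fin.
have := barrier_tangent bar sy1 tz1; have := barrier_tangent bar sy2 tz2.
rewrite -dz /=; nra.
Qed.

(** The two arguments average to -z, so convexity bounds psi^eq from below by its value at 0.
    Conversely z = |t| - s puts one argument at s and the other at s - 2|t|; the decrease of [b]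
    over this distance pays for the extra cost rho * |t|. *)
Lemma psieq_constant rho : (forall s, s < 0 -> rho <= d s *+ 2) -> forall t,
  psieq b rho t = ereal_inf [set (B s *+ 2 - rho * s)%:E | s in [set s : R | (s < 0)%R]].
Proof.
move=> rd t.
apply/eqP; rewrite eq_le; apply/andP; split; apply: le_ereal_inf_tmp.
  suff H s : s < 0 -> (psieq b rho t <= (B s *+ 2 - rho * s)%:E)%E.
    by move=> _ [s s0 <-]; exact: H.
  move=> s0; have := normr_ge0 t; have := ler_norm t; have := ler_norm (- t).
  rewrite normrN => T1 T2 T3.
  apply: le_trans (_ : (rho * (`|t| - s) + B (t - (`|t| - s)) + B (- t - (`|t| - s)))%:E <= _)%E.
    by apply: psieq_le; lra.
  rewrite lee_fin.
  have : `|t| = t \/ `|t| = - t.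
    by case: (leP 0 t) => t0; [left; rewrite ger0_norm|right; rewrite ltr0_norm].
  move: T1 T2 T3; move: `|t| => r T1 T2 T3 [rE|rE].
    have s2 : - t - (r - s) < 0 by lra.
    have -> : t - (r - s) = s by rewrite rE; ring.
    have /= := barrier_tangent bar s0 s2; have := rd _ s2; rewrite mulr2n; nra.
  have s2 : t - (r - s) < 0 by lra.
  have -> : - t - (r - s) = s by rewrite rE; ring.
  have /= := barrier_tangent bar s0 s2; have := rd _ s2; rewrite mulr2n; nra.
move=> _ [z _ <-].
have [tz1|tz1] := ltP (t - z) 0; last first.
  by rewrite (barrier_pinfty bar tz1) addey// addye ?leey ?(barrier_neq_ninfty bar).
have [tz2|tz2] := ltP (- t - z) 0; last first.
  by rewrite (barrier_pinfty bar tz2) (barrierE bar tz1) -EFinD addey// leey.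
apply: (@le_trans _ _ (B (- z) *+ 2 - rho * - z)%:E).
  by apply: ereal_inf_lbound; exists (- z) => //=; lra.
rewrite !(barrierE bar)// -!EFinD lee_fin.
have z0 : - z < 0 by lra.
have := barrier_tangent bar tz1 z0; have := barrier_tangent bar tz2 z0.
rewrite mulr2n /=; nra.
Qed.

(** Intermediate values in z: at |t| - s both arguments are at most s, so the sum is at most rho; at
    |t| - u one argument equals u, where b' already exceeds rho. *)
Lemma barrier_balance rho t : 0 < rho -> (exists2 s, s < 0 & d s *+ 2 < rho) ->
  exists2 z, `|t| < z & d (t - z) + d (- t - z) = rho.
Proof.
move=> rho0 [s s0 sr]; have [u u0 ru] := barrier_derive_unbounded bar rho.
have su : s < u.
  rewrite ltNge; apply/negP => us.
  have := barrier_derive_le bar us s0; have := barrier_incr bar s0; rewrite mulr2n in sr; lra.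
pose g z := d (t - z) + d (- t - z).
have T : `|t| = t \/ `|t| = - t.
  by case: (leP 0 t) => t0; [left; rewrite ger0_norm|right; rewrite ltr0_norm].
have := normr_ge0 t; have := ler_norm t; have := ler_norm (- t).
rewrite normrN => T1 T2 T3.
have dg z : `|t| < z -> derivable g z 1.
  move=> tz.
  have ta : t - z < 0 by lra.
  have tb : - t - z < 0 by lra.
  have E1 y : t - y = t - z + -1 * (y - z) by ring.
  have E2 y : - t - y = - t - z + -1 * (y - z) by ring.
  have d1 := is_derive1_comp_affine E1 (barrier_derivable2 bar ta).
  have d2 := is_derive1_comp_affine E2 (barrier_derivable2 bar tb).
  by apply: derivableD; apply: ex_derive.
have gs : g (`|t| - s) <= rho.
  have A1 : t - (`|t| - s) <= s by lra.
  have A2 : - t - (`|t| - s) <= s by lra.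
  have := barrier_derive_le bar A1 s0; have := barrier_derive_le bar A2 s0.
  rewrite /g; rewrite mulr2n in sr; lra.
have gu : rho <= g (`|t| - u).
  case: T => tE.
    have A1 : t - (`|t| - u) = u by rewrite tE; ring.
    have A2 : - t - (`|t| - u) < 0 by lra.
    by have := barrier_incr bar A2; rewrite /g A1; lra.
  have A1 : - t - (`|t| - u) = u by rewrite tE; ring.
  have A2 : t - (`|t| - u) < 0 by lra.
  by have := barrier_incr bar A2; rewrite /g A1; lra.
have [|||z zI gz] := @IVT _ g (`|t| - u) (`|t| - s) rho.
- lra.
- apply: derivable_within_continuous => z; rewrite in_itv /= => /andP[uz _].
  by apply: dg; lra.
- by rewrite ge_min gs orbT le_max gu.
exists z => //; move: zI; rewrite in_itv /= => /andP[uz _]; lra.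
Qed.

(** In the attained case rho + D(t) = 2 b'(t - Z), and for t < 0 the constraint Z > |t| gives t - Z
    < 2t: hence both factors 2. The bound for t > 0 is symmetric; in the other case psi^eq is
    constant. *)
Lemma psieq_smooth rho t0 : 0 < rho -> psieq b rho t0 \is a fin_num ->
  let D := derive1 (fine \o psieq b rho) in
  smooth_convex (psieq b rho) /\ forall t,
  [/\ - rho <= D t <= rho, (t < 0 -> rho + D t <= d (t *+ 2) *+ 2) &
      (0 < t -> rho - D t <= d (- (t *+ 2)) *+ 2)].
Proof.
move=> rho0 fin; have [ds|nd] := pselect (exists2 s, s < 0 & d s *+ 2 < rho); last first.
  have {}nd s : s < 0 -> rho <= d s *+ 2.
    by move=> s0; rewrite leNgt; apply/negP => ds; apply: nd; exists s.
  have /= psiE := psieq_constant nd.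
  move: fin; rewrite psiE => Cfin; set C := ereal_inf _ in Cfin psiE.
  have [t|sc DE] := @smooth_convex_touching _ (psieq b rho) (fun=> 0).
    exists (fun s => fine C); split.
    - exact: is_derive_cst.
    - by rewrite psiE fineK.
    - by move=> s; rewrite mul0r addr0 psiE fineK.
    - by near=> s; rewrite psiE fineK.
  split=> // t; rewrite DE; split=> [|t'|t'].
  - by rewrite oppr_le0 (ltW rho0).
  - by rewrite addr0 nd// mulr2n; lra.
  - by rewrite subr0 nd// mulr2n; lra.
have /choice[Z ZP] t : exists z, `|t| < z /\ d (t - z) + d (- t - z) = rho.
  by have [z ? ?] := barrier_balance t rho0 ds; exists z.
have tZ t : `|t| < Z t by have [] := ZP t.
have dZ t : d (t - Z t) + d (- t - Z t) = rho by have [] := ZP t.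
have ta t : t - Z t < 0 by have := tZ t; rewrite ltr_norml => /andP[]; lra.
have tb t : - t - Z t < 0 by have := tZ t; rewrite ltr_norml => /andP[]; lra.
have [t|sc DE] :=
    @smooth_convex_touching _ (psieq b rho) (fun t => d (t - Z t) - d (- t - Z t)).
  exists (fun s => rho * Z t + B (s - Z t) + B (- s - Z t)); split.
  - have E1 s : s - Z t = t - Z t + 1 * (s - t) by ring.
    have E2 s : - s - Z t = - t - Z t + -1 * (s - t) by ring.
    have d1 := is_derive1_comp_affine E1 (barrier_is_derive bar (ta t)).
    have d2 := is_derive1_comp_affine E2 (barrier_is_derive bar (tb t)).
    apply: is_derive_eq (_ : 0 + d (t - Z t) * 1 + d (- t - Z t) * -1 = _); ring.
  - apply/eqP; rewrite eq_le psieq_le//=.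
    by have := psieq_ge t (tZ t) (dZ t); rewrite subrr mulr0 addr0.
  - by move=> s; apply: psieq_ge.
  - near=> s; apply: psieq_le; near: s.
    by apply: cvgr_lt (tZ t); exact: norm_continuous.
split=> // t; rewrite DE; split.
- have := barrier_incr bar (ta t); have := barrier_incr bar (tb t); rewrite -(dZ t); lra.
- move=> t1; have := tZ t; rewrite ltr_norml => /andP[t2 t3].
  have tt : t *+ 2 < 0 by rewrite mulr2n; lra.
  have tt2 : t - Z t <= t *+ 2 by rewrite mulr2n; lra.
  by have := barrier_derive_le bar tt2 tt; rewrite -{1}(dZ t) [in X in _ -> X]mulr2n; lra.
- move=> t1; have := tZ t; rewrite ltr_norml => /andP[t2 t3].
  have tt : - (t *+ 2) < 0 by rewrite mulr2n; lra.
  have tt2 : - t - Z t <= - (t *+ 2) by rewrite mulr2n; lra.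
  by have := barrier_derive_le bar tt2 tt; rewrite -{1}(dZ t) [in X in _ -> X]mulr2n; lra.
Unshelve. all: by end_near. Qed.
End MarginalPenalties.

(** * Subgradients of the subproblem *)

Section Euclidean.
Variables (R : realType) (n : nat).
Implicit Types (u v w x y : 'rV[R]_n) (k e : R).

Lemma ler_coord_norm u i : `|u 0 i| <= `|u|.
Proof.
by rewrite [leRHS]mx_normrE; exact: (le_bigmax _ (fun ij => `|u ij.1 ij.2|) (0, i)).
Qed.

Lemma rV_norm_le u (M : R) : 0 <= M -> (forall i, `|u 0 i| <= M) -> `|u| <= M.
Proof.
move=> M0 uM; rewrite [leLHS]mx_normrE; apply/bigmax_leP; split=> // -[i j] _ /=.
by rewrite ord1.
Qed.

Lemma dotvC u v : dotv u v = dotv v u.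
Proof. by apply: eq_bigr => i _; rewrite mulrC. Qed.

Lemma dotvDl u v w : dotv (u + v) w = dotv u w + dotv v w.
Proof. by rewrite -big_split; apply: eq_bigr => i _; rewrite mxE mulrDl. Qed.

Lemma dotvZl k u w : dotv (k *: u) w = k * dotv u w.
Proof. by rewrite mulr_sumr; apply: eq_bigr => i _; rewrite mxE mulrA. Qed.

Lemma dotvNl u w : dotv (- u) w = - dotv u w.
Proof. by rewrite -scaleN1r dotvZl mulN1r. Qed.

Lemma dotvBl u v w : dotv (u - v) w = dotv u w - dotv v w.
Proof. by rewrite dotvDl dotvNl. Qed.

Lemma dotvDr u v w : dotv w (u + v) = dotv w u + dotv w v.
Proof. by rewrite !(dotvC w) dotvDl. Qed.

Lemma dotvBr u v w : dotv w (u - v) = dotv w u - dotv w v.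
Proof. by rewrite !(dotvC w) dotvBl. Qed.

Lemma normr_dotv_le u v : `|dotv u v| <= n%:R * `|u| * `|v|.
Proof.
apply: le_trans (ler_norm_sum _ _ _) _.
apply: (@le_trans _ _ (\sum_(i < n) `|u| * `|v|)).
  by apply: ler_sum => i _; rewrite normrM; apply: ler_pM => //; exact: ler_coord_norm.
by rewrite sumr_const card_ord mulr_natl mulrnAl.
Qed.

Lemma dotvv_ge0 u : 0 <= dotv u u.
Proof. by apply: sumr_ge0 => i _; rewrite -expr2 sqr_ge0. Qed.

Lemma sqr_norm_le_dotvv u : `|u| ^+ 2 <= dotv u u.
Proof.
rewrite -[leRHS]sqr_sqrtr ?dotvv_ge0// ler_sqr ?nnegrE ?sqrtr_ge0//.
apply: rV_norm_le => [|i]; first exact: sqrtr_ge0.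
rewrite -sqrtr_sqr ler_wsqrtr// /dotv (bigD1 i)//= expr2 lerDl.
by apply: sumr_ge0 => j _; rewrite -expr2 sqr_ge0.
Qed.

Lemma norm_le_l2norm u : `|u| <= l2norm u.
Proof.
rewrite -(@ler_pXn2r _ 2) ?nnegrE ?sqrtr_ge0// sqr_sqrtr ?dotvv_ge0//.
exact: sqr_norm_le_dotvv.
Qed.

Lemma l2norm_le_norm u : l2norm u <= n%:R * `|u|.
Proof.
rewrite -(@ler_pXn2r _ 2) ?nnegrE ?sqrtr_ge0 ?mulr_ge0// sqr_sqrtr ?dotvv_ge0//.
apply: le_trans (ler_norm _) _; apply: le_trans (normr_dotv_le u u) _.
rewrite exprMn -mulrA -expr2 ler_wpM2r ?sqr_ge0// -natrX ler_nat.
by case: (n) => // k; rewrite expnS leq_pmulr// expn_gt0.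
Qed.

Lemma l2normN u : l2norm (- u) = l2norm u.
Proof. by rewrite /l2norm dotvNl dotvC dotvNl opprK. Qed.

(** A remainder o(|y - x|) is the same for equivalent norms: [e] absorbs the factor n, taken as n +
    1 to cover n = 0. *)
Lemma regular_subdiffP (f : 'rV[R]_n -> \bar R) x v : regular_subdiff f x v <->
  f x \is a fin_num /\ forall e, 0 < e -> \forall y \near x,
    (f x + (dotv v (y - x) - e * `|y - x|)%:E <= f y)%E.
Proof.
split=> -[fx H]; split=> // e e0.
  have N0 : 0 < n%:R + 1 :> R by rewrite ltr_wpDl.
  have e1 : 0 < e / (n%:R + 1) by rewrite divr_gt0.
  apply: filterS (H _ e1) => y; apply: le_trans.
  apply: leeD => //; rewrite lee_fin lerB// mulrAC ler_pdivrMr//.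
  rewrite -mulrA ler_pM2l// (le_trans (l2norm_le_norm _))// mulrC ler_wpM2l//.
  by rewrite lerDl.
apply: filterS (H _ e0) => y; apply: le_trans.
by apply: leeD => //; rewrite lee_fin lerB// ler_pM2l// norm_le_l2norm.
Qed.

End Euclidean.

(** * Gradients and the sum rule for smooth perturbations *)

Section Gradients.
Variables (R : realType) (n : nat).
Implicit Types (g h : 'rV[R]_n -> R) (x G H : 'rV[R]_n) (k e : R).

(** Differentiability in the remainder form of [regular_subdiffP], so that sum rules amount to
    adding inequalities. *)
Definition has_grad g x G := forall e, 0 < e ->
  \forall y \near x, `|g y - g x - dotv G (y - x)| <= e * `|y - x|.

Lemma has_gradD g h x G H :
  has_grad g x G -> has_grad h x H -> has_grad (g \+ h) x (G + H).
Proof.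
move=> gG hH e e0; have e2 : 0 < e / 2 by lra.
near=> y.
have A : `|g y - g x - dotv G (y - x)| <= e / 2 * `|y - x| by near: y; exact: gG.
have A' : `|h y - h x - dotv H (y - x)| <= e / 2 * `|y - x| by near: y; exact: hH.
rewrite dotvDl /= (_ : _ - _ =
  (g y - g x - dotv G (y - x)) + (h y - h x - dotv H (y - x))); last by ring.
by apply: le_trans (ler_normD _ _) _; lra.
Unshelve. all: by end_near. Qed.

Lemma has_gradZ k g x G : has_grad g x G -> has_grad (fun y => k * g y) x (k *: G).
Proof.
move=> gG e e0; have k0 : 0 < `|k| + 1 by rewrite ltr_wpDl.
have e1 : 0 < e / (`|k| + 1) by rewrite divr_gt0.
apply: filterS (gG _ e1) => y H.
rewrite dotvZl -!mulrBr normrM.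
apply: le_trans (ler_wpM2l (normr_ge0 k) H) _.
rewrite mulrA; apply: ler_wpM2r => //.
by rewrite mulrCA ger_pMr// ler_pdivrMr// mul1r lerDl.
Qed.

Lemma has_grad_cst k x : has_grad (fun=> k) x 0.
Proof.
move=> e e0; near=> y; rewrite subrr sub0r normrN /dotv big1 => [|i _].
  by rewrite normr0 mulr_ge0// ltW.
by rewrite mxE mul0r.
Unshelve. all: by end_near. Qed.

Lemma has_grad_sum I (r : seq I) (g : I -> 'rV[R]_n -> R) x (G : I -> 'rV[R]_n) :
  (forall i, has_grad (g i) x (G i)) ->
  has_grad (fun y => \sum_(i <- r) g i y) x (\sum_(i <- r) G i).
Proof.
move=> gG; elim: r => [|i r IH].
  rewrite big_nil (_ : (fun _ => _) = (fun=> 0)); first exact: has_grad_cst.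
  by apply/funext => y; rewrite big_nil.
rewrite big_cons (_ : (fun _ => _) = g i \+ (fun y => \sum_(i <- r) g i y)).
  exact: has_gradD.
by apply/funext => y; rewrite big_cons.
Qed.

Lemma has_grad_lipschitz g x G : has_grad g x G ->
  \forall y \near x, `|g y - g x| <= (n%:R * `|G| + 1) * `|y - x|.
Proof.
move=> /(_ 1 ltr01); apply: filterS => y H.
rewrite -(subrK (dotv G (y - x)) (g y - g x)) mulrDl addrC.
apply: le_trans (ler_normD _ _) _; apply: lerD => //; exact: normr_dotv_le.
Qed.

Lemma has_grad_continuous g x G : has_grad g x G -> g y @[y --> x] --> g x.
Proof.
move=> /has_grad_lipschitz gG; apply/(cvgrPdist_le (F := nbhs x)) => e e0.
have K0 : 0 < n%:R * `|G| + 1 by rewrite ltr_wpDl// mulr_ge0.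
near=> y; rewrite distrC.
have /le_trans-> // : `|g y - g x| <= (n%:R * `|G| + 1) * `|y - x| by near: y.
rewrite mulrC -ler_pdivlMr// distrC; near: y.
by apply: cvgr_dist_le; [exact: cvg_id|rewrite divr_gt0].
Unshelve. all: by end_near. Qed.

Lemma has_grad_comp (phi : R -> R) g x G (D : R) : has_grad g x G ->
  is_derive (g x) 1 phi D -> has_grad (phi \o g) x (D *: G).
Proof.
move=> gG /is_derive1P dphi e e0.
have K0 : 0 < n%:R * `|G| + 1 by rewrite ltr_wpDl// mulr_ge0.
have D0 : 0 < `|D| + 1 by rewrite ltr_wpDl.
have e1 : 0 < e / 2 / (n%:R * `|G| + 1) by rewrite !divr_gt0.
have e2 : 0 < e / 2 / (`|D| + 1) by rewrite !divr_gt0.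
have near_phi := has_grad_continuous gG (dphi _ e1).
near=> y.
have A : `|phi (g y) - phi (g x) - D * (g y - g x)| <=
    e / 2 / (n%:R * `|G| + 1) * `|g y - g x|.
  by near: y; exact: near_phi.
have A1 : `|g y - g x| <= (n%:R * `|G| + 1) * `|y - x|.
  by near: y; exact: has_grad_lipschitz.
have A2 : `|g y - g x - dotv G (y - x)| <= e / 2 / (`|D| + 1) * `|y - x|.
  by near: y; exact: gG.
rewrite dotvZl /= (_ : _ - _ = (phi (g y) - phi (g x) - D * (g y - g x)) +
  D * (g y - g x - dotv G (y - x))); last by ring.
apply: le_trans (ler_normD _ _) _; rewrite normrM.
have {}A : `|phi (g y) - phi (g x) - D * (g y - g x)| <= e / 2 * `|y - x|.
  apply: le_trans A _; apply: le_trans (ler_wpM2l (ltW e1) A1) _.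
  by rewrite mulrA divfK ?lt0r_neq0.
have {}A2 : `|D| * `|g y - g x - dotv G (y - x)| <= e / 2 * `|y - x|.
  apply: le_trans (ler_wpM2l (normr_ge0 D) A2) _; rewrite mulrA; apply: ler_wpM2r => //.
  by rewrite mulrCA ger_pMr ?divr_gt0// ler_pdivrMr// mul1r lerDl.
lra.
Unshelve. all: by end_near. Qed.

Lemma differentiable_has_grad m (f : 'rV[R]_n -> 'rV[R]_m) x i :
  differentiable f x -> has_grad (fun y => f y 0 i) x (row i (jacobian f x)^T).
Proof.
move=> df e e0.
have := diff_locally df => /eqaddoP /(_ _ e0).
move=> /nbhs_normP[r /= r0 Hr]; apply/nbhs_normP; exists r => // y /= xy.
have := Hr (y - x); rewrite /ball_ /= sub0r normrN distrC => /(_ xy).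
rewrite !fctE /= subrK; apply: le_trans.
have -> : f y 0 i - f x 0 i - dotv (row i (jacobian f x)^T) (y - x) =
    (f y - (f x + 'd f x (y - x))) 0 i.
  rewrite !mxE opprD addrA; congr (_ - _).
  rewrite -(deriveE _ df) deriveEjacobian// mxE /dotv; apply: eq_bigr => j _.
  by rewrite !mxE mulrC.
exact: ler_coord_norm.
Qed.

Lemma JacT_sum m (f : 'rV[R]_n -> 'rV[R]_m) x (y : 'rV[R]_m) :
  JacT f x y = \sum_i y 0 i *: row i (jacobian f x)^T.
Proof. exact: mulmx_sum_row. Qed.

Lemma regular_subdiff_subgrad (q : 'rV[R]_n -> \bar R) g x v G : has_grad g x G ->
  regular_subdiff (fun y => q y + (g y)%:E)%E x v -> regular_subdiff q x (v - G).
Proof.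
move=> gG /regular_subdiffP[]; rewrite fin_numD /= andbT => qx H.
apply/regular_subdiffP; split=> // e e0; have e2 : 0 < e / 2 by lra.
near=> y.
have : (q x + (g x)%:E + (dotv v (y - x) - e / 2 * `|y - x|)%:E <= q y + (g y)%:E)%E.
  by near: y; exact: H.
have : `|g y - g x - dotv G (y - x)| <= e / 2 * `|y - x| by near: y; exact: gG.
move=> /(le_trans (ler_norm _)) A; rewrite dotvBl.
rewrite -leeBlDr//; apply: le_trans.
rewrite -(fineK qx) -!EFinD lee_fin; lra.
Unshelve. all: by end_near. Qed.

(** The gradient is subtracted along the approximating sequence. Continuity of [g] transfers the
    convergence of function values to [q], and continuity of [G] that of the subgradients. *)
Lemma limiting_subdiff_subgrad (q : 'rV[R]_n -> \bar R) g (G : 'rV[R]_n -> 'rV[R]_n) x v :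
  (forall y, has_grad g y (G y)) -> continuous G ->
  limiting_subdiff (fun y => q y + (g y)%:E)%E x v ->
  limiting_subdiff q x (v - G x).
Proof.
move=> gG cG [fx [xs [vs [xsx fxs vsv rs]]]].
have qx : q x \is a fin_num by move: fx; rewrite fin_numD andbT.
split=> //; exists xs, (fun j => vs j - G (xs j)); split=> //.
- have gx : (g (xs j))%:E @[j --> \oo] --> (g x)%:E.
    apply: cvg_EFin; first exact: nearW.
    exact: (cvg_comp xs g xsx (has_grad_continuous (gG x))).
  have dq : (q x + (g x)%:E +? - (g x)%:E)%E by exact: fin_num_adde_defl.
  have := cvgeB dq fxs gx; rewrite addeK//.
  by under eq_fun do rewrite addeK//; apply.
- exact: (cvgB vsv (cvg_comp xs G xsx (cG x))).
- by move=> j; apply: regular_subdiff_subgrad.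
Qed.

End Gradients.

Section Limits.
Variables (R : realType) (T : Type) (F : set_system T).
Context {FF : Filter F}.

Lemma rV_cvg n (u : T -> 'rV[R]_n) (l : 'rV[R]_n) :
  (forall i, u t 0 i @[t --> F] --> l 0 i) -> u t @[t --> F] --> l.
Proof.
move=> ul; apply/cvgrPdist_le => e e0.
have H : \forall t \near F, forall i, `|l 0 i - u t 0 i| <= e.
  apply: filter_forall => i.
  by have /cvgrPdist_le := ul i; apply.
apply: filterS H => t ut; apply: rV_norm_le => [|i]; first exact: ltW.
by rewrite !mxE.
Qed.

Lemma row_cvg n (g : T -> 'I_n -> R) (l : 'I_n -> R) :
  (forall i, g t i @[t --> F] --> l i) -> \row_i g t i @[t --> F] --> \row_i l i.
Proof.
move=> gl; apply: rV_cvg => i.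
have E : (fun t => (\row_i g t i) 0 i) = g^~ i by apply/funext => t; rewrite mxE.
by rewrite E mxE.
Qed.

Lemma rV_cvg_coord n m (A : T -> 'M[R]_(n, m)) (L : 'M[R]_(n, m)) i j :
  A t @[t --> F] --> L -> A t i j @[t --> F] --> L i j.
Proof.
move=> AL; have coord := @coord_continuous _ _ _ i j L.
exact: (cvg_comp A (fun M : 'M[R]_(n, m) => M i j) AL coord).
Qed.

Lemma sum_cvg I (r : seq I) (g : I -> T -> R) (l : I -> R) :
  (forall i, g i t @[t --> F] --> l i) ->
  \sum_(i <- r) g i t @[t --> F] --> \sum_(i <- r) l i.
Proof.
by move=> gl; apply: (cvg_big (op := +%R)); [exact: add_continuous|move=> i _; exact: gl].
Qed.

Lemma JacT_cvg n m (f : 'rV[R]_n -> 'rV[R]_m) (x : T -> 'rV[R]_n) (y : T -> 'rV[R]_m) xl yl :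
  continuous (jacobian f) -> x t @[t --> F] --> xl -> y t @[t --> F] --> yl ->
  JacT f (x t) (y t) @[t --> F] --> JacT f xl yl.
Proof.
move=> cf xxl yyl; apply: rV_cvg => i.
have JE z w : JacT f z w 0 i = \sum_j w 0 j * jacobian f z i j.
  by rewrite mxE; apply: eq_bigr => j _; rewrite mxE.
have Jx := cvg_comp x (jacobian f) xxl (cf xl).
have S : \sum_j y t 0 j * jacobian f (x t) i j @[t --> F] --> \sum_j yl 0 j * jacobian f xl i j.
  by apply: sum_cvg => j; apply: cvgM; [exact: (rV_cvg_coord yyl)|exact: (rV_cvg_coord Jx)].
have E1 : (fun t => JacT f (x t) (y t) 0 i) = (fun t => \sum_j y t 0 j * jacobian f (x t) i j).
  by apply/funext => t; exact: JE.
have E2 := JE xl yl.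
by rewrite E1 E2.
Qed.

End Limits.

Lemma fin_num_pmulr (R : realType) (r : R) (z : \bar R) :
  0 < r -> (r%:E * z)%E \is a fin_num -> z \is a fin_num.
Proof. by case: z => // r0; rewrite ?gt0_muley ?gt0_muleNy ?lte_fin. Qed.

(** * The subproblem objective and its multipliers *)

Section Subproblem.
Variables (R : realType) (n m meq : nat).
Variables (b : R -> \bar R) (q : 'rV[R]_n -> \bar R)
  (c : 'rV[R]_n -> 'rV[R]_m) (ceq : 'rV[R]_n -> 'rV[R]_meq).
Hypotheses (bar : barrier b) (c_C1 : C1 c) (ceq_C1 : C1 ceq).
Implicit Types (a mu e : R) (x y v : 'rV[R]_n).

Local Notation d := (derive1 (fine \o b)).
Local Notation F := (subproblem_obj b q c ceq).

(** The smooth part of the objective as a real function; [fine] loses nothing once the objective is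
    finite at one point. *)
Definition penalty a mu x : R :=
  mu * (\sum_(i < m) fine (psi b (a / mu) (c x 0 i))) +
  mu * (\sum_(j < meq) fine (psieq b (a / mu) (ceq x 0 j))).

Definition penalty_grad a mu x : 'rV[R]_n :=
  JacT c x (\row_i mult b c a mu x i) + JacT ceq x (\row_j multeq b ceq a mu x j).

Lemma C1_cvg_coord k (f : 'rV[R]_n -> 'rV[R]_k) y i : C1 f -> f z 0 i @[z --> y] --> f y 0 i.
Proof. by move=> f1; exact: (has_grad_continuous (differentiable_has_grad i (f1.1 y))). Qed.

Section FiniteSubproblem.
Variables (a mu : R) (x0 : 'rV[R]_n).
Hypotheses (a0 : 0 < a) (mu0 : 0 < mu) (Fx0 : F a mu x0 \is a fin_num).

Let rho0 : 0 < a / mu. Proof. exact: divr_gt0. Qed.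

Lemma subproblem_fin_num : [/\ q x0 \is a fin_num,
  forall i, psi b (a / mu) (c x0 0 i) \is a fin_num &
  forall j, psieq b (a / mu) (ceq x0 0 j) \is a fin_num].
Proof.
move: Fx0; rewrite /subproblem_obj !fin_numD => /andP[/andP[qx /(fin_num_pmulr mu0) A]].
move=> /(fin_num_pmulr mu0) B; split=> // i.
- by move/sum_fin_numP : A; apply => //; rewrite mem_index_enum.
- by move/sum_fin_numP : B; apply => //; rewrite mem_index_enum.
Qed.

(** The index carries information: a finite objective says something about psi only if there is an
    inequality constraint. *)
Lemma psi_smooth_subproblem (i : 'I_m) : smooth_convex (psi b (a / mu)).
Proof. by have [_ /(_ i) H _] := subproblem_fin_num; have [] := psi_smooth bar H. Qed.

Lemma psieq_smooth_subproblem (j : 'I_meq) : smooth_convex (psieq b (a / mu)).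
Proof. by have [_ _ /(_ j) H] := subproblem_fin_num; have [] := psieq_smooth bar rho0 H. Qed.

Lemma subproblem_objE : F a mu = fun y => (q y + (penalty a mu y)%:E)%E.
Proof.
apply/funext => y; rewrite /subproblem_obj -addeA /penalty EFinD !EFinM -!sumEFin.
congr (_ + (_ * _ + _ * _))%E; apply: eq_bigr => i _; rewrite fineK//.
- exact/smooth_fin/psi_smooth_subproblem.
- exact/smooth_fin/psieq_smooth_subproblem.
Qed.

Lemma penalty_has_grad y : has_grad (penalty a mu) y (penalty_grad a mu y).
Proof.
rewrite /penalty_grad !JacT_sum; apply: has_gradD.
- rewrite [X in has_grad _ _ X](_ : _ = mu *: \sum_i
    (derive1 (fine \o psi b (a / mu)) (c y 0 i) *: row i (jacobian c y)^T)); last first.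
    by rewrite scaler_sumr; apply: eq_bigr => i _; rewrite mxE scalerA.
  apply: has_gradZ; apply: has_grad_sum => i.
  have dpsi := smooth_is_derive (psi_smooth_subproblem i) (c y 0 i).
  exact: (has_grad_comp (differentiable_has_grad i (c_C1.1 y)) dpsi).
- rewrite [X in has_grad _ _ X](_ : _ = mu *: \sum_i
    (derive1 (fine \o psieq b (a / mu)) (ceq y 0 i) *: row i (jacobian ceq y)^T)); last first.
    by rewrite scaler_sumr; apply: eq_bigr => i _; rewrite mxE scalerA.
  apply: has_gradZ; apply: has_grad_sum => i.
  have dpsi := smooth_is_derive (psieq_smooth_subproblem i) (ceq y 0 i).
  exact: (has_grad_comp (differentiable_has_grad i (ceq_C1.1 y)) dpsi).
Qed.

Lemma penalty_grad_continuous : continuous (penalty_grad a mu).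
Proof.
move=> y.
have mult_cvg : \row_i mult b c a mu z i @[z --> y] --> \row_i mult b c a mu y i.
  apply: (row_cvg (F := nbhs y)) => i.
  have Dpsi := @smooth_derive_continuous _ _ (psi_smooth_subproblem i) (c y 0 i).
  have ci := @C1_cvg_coord _ c y i c_C1.
  exact: (cvgM (cvg_cst mu) (cvg_comp (fun z => c z 0 i) _ ci Dpsi)).
have multeq_cvg : \row_j multeq b ceq a mu z j @[z --> y] --> \row_j multeq b ceq a mu y j.
  apply: (row_cvg (F := nbhs y)) => j.
  have Dpsi := @smooth_derive_continuous _ _ (psieq_smooth_subproblem j) (ceq y 0 j).
  have cj := @C1_cvg_coord _ ceq y j ceq_C1.
  exact: (cvgM (cvg_cst mu) (cvg_comp (fun z => ceq z 0 j) _ cj Dpsi)).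
have idy : z @[z --> y] --> y by exact: cvg_id.
have Jc := JacT_cvg (F := nbhs y) c_C1.2 idy mult_cvg.
have Jceq := JacT_cvg (F := nbhs y) ceq_C1.2 idy multeq_cvg.
exact: (cvgD (Jc _) (Jceq _)).
Qed.

Lemma mult_bounds x i :
  [/\ 0 <= mult b c a mu x i, mult b c a mu x i <= a,
      0 <= c x 0 i -> mult b c a mu x i = a &
      c x 0 i < 0 -> mult b c a mu x i <= mu * d (c x 0 i)].
Proof.
have aE : a = mu * (a / mu) by rewrite mulrC divfK// gt_eqF.
have [_ /(_ i) psi_fin _] := subproblem_fin_num.
have [_ /(_ (c x 0 i)) [H1 H2 H3 H4]] := psi_smooth bar psi_fin.
rewrite /mult; split.
- by apply: mulr_ge0; [exact: ltW|exact: H1].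
- by rewrite [leRHS]aE ler_pM2l.
- by move=> /H3 ->; rewrite -aE.
- by move=> /H4 ?; rewrite ler_pM2l.
Qed.

Lemma multeq_bounds x j :
  [/\ - a <= multeq b ceq a mu x j <= a,
      ceq x 0 j < 0 -> a + multeq b ceq a mu x j <= mu * d (ceq x 0 j *+ 2) *+ 2 &
      0 < ceq x 0 j -> a - multeq b ceq a mu x j <= mu * d (- (ceq x 0 j *+ 2)) *+ 2].
Proof.
have aE : a = mu * (a / mu) by rewrite mulrC divfK// gt_eqF.
have [_ _ /(_ j) psi_fin] := subproblem_fin_num.
have [_ /(_ (ceq x 0 j)) [/andP[H1 H2] H3 H4]] := psieq_smooth bar rho0 psi_fin.
rewrite /multeq; split.
- by rewrite {1 4}aE -mulrN !ler_pM2l// H1.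
- by move=> /H3 ?; rewrite {1}aE -mulrDr -mulrnAr ler_pM2l.
- by move=> /H4 ?; rewrite {1}aE -mulrBr -mulrnAr ler_pM2l.
Qed.

(* A complementarity term can exceed [e] only where a constraint has slack larger than
   [e]; there the multiplier is at most mu * b'(-e). *)
Lemma sres_le e x : 0 < e -> (mu * d (- e)) *+ 2 <= e -> sres b c ceq a mu x <= e.
Proof.
move=> e0 mue.
have Ne0 : - e < 0 by rewrite oppr_lt0.
have mud : 0 <= mu * d (- e) by rewrite mulr_ge0 ?ltW// barrier_incr.
have mu_le (t : R) : t <= - e -> mu * d t <= mu * d (- e).
  by move=> te; rewrite ler_pM2l// barrier_derive_le.
rewrite mulr2n in mue.
rewrite /sres ge_max; apply/andP; split; apply/bigmax_leP; split; rewrite ?(ltW e0)// => i _.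
- have [y0 ya yp yn] := mult_bounds x i; move: yp yn.
  rewrite /neg_part /pos_part; move: (c x 0 i) => t yp yn.
  rewrite ge_max; apply/andP; split; rewrite ger0_norm.
  + rewrite ge_min; have [t0|t0] := leP 0 t.
      by apply/orP; right; rewrite ge_max (ltW e0) /=; lra.
    have [te|te] := leP t (- e); last by apply/orP; right; rewrite ge_max; lra.
    by apply/orP; left; have := mu_le _ te; have := yn t0; lra.
  + by rewrite le_min y0 le_max lexx.
  + rewrite ge_min; have [/yp->|t0] := leP 0 t.
      by rewrite subrr (ltW e0).
    by rewrite (ltW e0) orbT.
  + by rewrite le_min subr_ge0 ya le_max lexx.
(* For equalities the bounds contain b' twice, whence the doubled term in the hypothesis; the
   doubled argument still lies below -e. *)
- have [/andP[y0 ya] yn yp] := multeq_bounds x i; move: yp yn.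
  rewrite /neg_part /pos_part; move: (ceq x 0 i) => t yp yn.
  rewrite ge_max; apply/andP; split; rewrite ger0_norm.
  + rewrite ge_min; have [te|te] := leP t (- e); last first.
      by apply/orP; right; rewrite ge_max; lra.
    have t0 : t < 0 by lra.
    have te2 : t *+ 2 <= - e by rewrite mulr2n; lra.
    by apply/orP; left; have := mu_le _ te2; have := yn t0; rewrite mulr2n; lra.
  + by rewrite le_min le_max lexx andbT; lra.
  + rewrite ge_min; have [te|te] := leP e t; last first.
      by apply/orP; right; rewrite ge_max; lra.
    have t0 : 0 < t by lra.
    have te2 : - (t *+ 2) <= - e by rewrite mulr2n; lra.
    by apply/orP; left; have := mu_le _ te2; have := yp t0; rewrite mulr2n; lra.
  + by rewrite le_min subr_ge0 ya le_max lexx.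
Qed.

End FiniteSubproblem.

Lemma dist_le_ex (A : set 'rV[R]_n) v e : (dist v A <= e%:E)%E ->
  exists2 w, A w & l2norm (v - w) < e + 1.
Proof.
move=> dA; have : (dist v A < (e + 1)%:E)%E by rewrite (le_lt_trans dA)// lte_fin ltrDl.
by move=> /ereal_inf_lt[_ [w Aw <-]]; rewrite lte_fin => ?; exists w.
Qed.

(** A finite distance means a nonempty subdifferential, and a subgradient exists only at a point of
    finite value. *)
Lemma dist_subproblem_fin a mu x e :
  (dist 0 (limiting_subdiff (F a mu) x) <= e%:E)%E -> F a mu x \is a fin_num.
Proof. by move=> /dist_le_ex[w []]. Qed.

(** Each subgradient v of the objective gives the subgradient v - grad of [q], as far from -grad as
    v is from 0. The dual tolerance is thus inherited without loss, whether or not the distance is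
    attained. *)
Lemma stationary_KKT a mu x ep ed : 0 < a -> 0 < mu ->
  (dist 0 (limiting_subdiff (F a mu) x) <= ed%:E)%E ->
  pres c ceq x <= ep -> sres b c ceq a mu x <= ep -> KKT_point q c ceq ep ed x.
Proof.
move=> a0 mu0 dx; rewrite /pres ge_max => /andP[pc pceq] sx.
have Fx := dist_subproblem_fin dx.
exists (\row_i mult b c a mu x i), (\row_j multeq b ceq a mu x j); split=> //.
- apply: le_trans dx; apply: le_ereal_inf_tmp => _ [v Fv <-].
  apply: ereal_inf_lbound; exists (v - penalty_grad a mu x).
    apply: (limiting_subdiff_subgrad (g := penalty a mu)).
    + exact: penalty_has_grad Fx.
    + exact: penalty_grad_continuous Fx.
    + by rewrite -(subproblem_objE a0 mu0 Fx).
  by rewrite /penalty_grad sub0r; congr (l2norm _)%:E; rewrite opprB -opprD addKr.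
- by move=> i; rewrite mxE; have [] := mult_bounds a0 mu0 Fx x i.
- move=> i; rewrite mxE; apply: le_trans (ler_norm _) _.
  move: sx; rewrite /sres ge_max => /andP[/bigmax_leP[_ /(_ i isT)] + _].
  by rewrite ge_max => /andP[].
Qed.

End Subproblem.

(** * Evolution of the algorithm parameters *)

Section GeometricGrowth.
Variable R : realType.
Implicit Types (r M : R) (u : nat -> R).

(** Bernoulli's linear lower bound for a geometric sequence, then the Archimedean property. *)
Lemma geometric_growth u r M K : 1 < r -> 0 < u K ->
  (forall k, (K <= k)%N -> r * u k <= u k.+1) ->
  exists2 N, (K <= N)%N & forall k, (N <= k)%N -> M <= u k.
Proof.
move=> r1 uK ur; have r0 : 0 < r - 1 by rewrite subr_gt0.
have lin j : u K + j%:R * (u K * (r - 1)) <= u (j + K)%N.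
  elim: j => [|j IH]; first by rewrite mul0r addr0.
  have uj : u K <= u (j + K)%N.
    by apply: le_trans IH; rewrite lerDl !mulr_ge0// ltW.
  have A := ur (j + K)%N (leq_addl _ _).
  have B : u K * (r - 1) <= u (j + K)%N * (r - 1) by rewrite ler_pM2r.
  by rewrite addSn -natr1; lra.
have uKr : 0 < u K * (r - 1) by rewrite mulr_gt0.
have [j Mj] : exists j : nat, M / (u K * (r - 1)) <= j%:R.
  exists (Num.bound `|M / (u K * (r - 1))|); apply: le_trans (ler_norm _) _.
  exact/ltW/archi_boundP.
exists (j + K)%N; first exact: leq_addl.
move=> k jk; rewrite -(subnK (leq_trans (leq_addl _ _) jk)).
apply: le_trans (lin _); rewrite -[leLHS]add0r; apply: lerD; first exact: ltW.
rewrite -ler_pdivrMr//; apply: le_trans Mj _.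
by rewrite ler_nat leq_subRL ?(leq_trans (leq_addl _ _) jk)// addnC.
Qed.

Lemma geometric_small r M e : 0 < r < 1 -> 0 < e ->
  exists N, forall k, (N <= k)%N -> r ^+ k * M <= e.
Proof.
move=> /andP[r0 r1] e0.
have [|||N _ HN] := @geometric_growth (fun k => r^-1 ^+ k) r^-1 (M / e) 0%N.
- by rewrite invf_gt1.
- by rewrite expr0.
- by move=> k _; rewrite exprS.
exists N => k /HN; rewrite ler_pdivrMr// exprVn mulrC ler_pdivlMr ?exprn_gt0//.
by rewrite mulrC.
Qed.

End GeometricGrowth.

(** * Penalty and barrier parameters along a run, at reached iterations *)

Section AlgorithmRun.
Variables (R : realType) (n m meq : nat).
Variables (b : R -> \bar R) (q : 'rV[R]_n -> \bar R)
  (c : 'rV[R]_n -> 'rV[R]_m) (ceq : 'rV[R]_n -> 'rV[R]_meq).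
Variables (P : algo_params R) (x : nat -> 'rV[R]_n) (alpha mu eps : nat -> R).
Hypotheses (bar : barrier b) (Pok : algo_params_ok P)
  (run : algo_run b q c ceq P x alpha mu eps).

Local Notation d := (derive1 (fine \o b)).
Local Notation reached := (reached b c ceq P x alpha mu eps).
Local Notation stops := (stops b c ceq P x alpha mu eps).
Local Notation s k := (sres b c ceq (alpha k) (mu k) (x k)).
Local Notation p k := (pres c ceq (x k)).

Lemma reached_le j k : (j <= k)%N -> reached k -> reached j.
Proof. by move=> jk rk i ij; apply: rk; apply: leq_trans jk. Qed.

Lemma run_gt0 k : reached k -> 0 < alpha k /\ 0 < mu k.
Proof.
elim: k => [|k IH] rk.
  by rewrite (run_alpha0 run) (run_mu0 run); split; [exact: alpha0_gt0|exact: mu0_gt0].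
have [a0 mu0] := IH (reached_le (leqnSn k) rk).
have da : 0 < delta_alpha P by rewrite (lt_trans ltr01)// delta_alpha_gt1.
have /andP[dm _] := delta_mu_itv Pok.
rewrite (run_alpha run rk) (run_mu run rk).
by split; case: ifP => _ //; rewrite mulr_gt0.
Qed.

Lemma alpha_le k : reached k.+1 -> alpha k <= alpha k.+1.
Proof.
move=> rk; have [a0 _] := run_gt0 (reached_le (leqnSn k) rk).
by rewrite (run_alpha run rk); case: ifP => // _; rewrite ler_peMl ?ltW ?delta_alpha_gt1.
Qed.

Lemma mu_le k : reached k.+1 -> mu k.+1 <= mu k.
Proof.
move=> rk; have [_ mu0] := run_gt0 (reached_le (leqnSn k) rk).
have /andP[_ dm] := delta_mu_itv Pok.
by rewrite (run_mu run rk); case: ifP => // _; rewrite ler_piMl ?ltW.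
Qed.

Lemma mu_antimono j k : (j <= k)%N -> reached k -> mu k <= mu j.
Proof.
elim: k => [|k IH]; first by rewrite leqn0 => /eqP->.
rewrite leq_eqVlt ltnS => /predU1P[->//|jk] rk.
by apply: le_trans (mu_le rk) _; apply: IH jk _; apply: reached_le rk.
Qed.

Lemma eps_le k : reached k -> eps k <= Num.max (delta_eps P ^+ k * epsilon0 P) (eps_d P).
Proof.
have /andP[de de1] := delta_eps_itv Pok; have ed := eps_d_gt0 Pok.
elim: k => [|k IH] rk; first by rewrite (run_eps0 run) expr0 mul1r le_max lexx.
rewrite (run_eps run rk) ge_max; apply/andP; split; last by rewrite le_max lexx orbT.
rewrite exprS -mulrA.
have := IH (reached_le (leqnSn k) rk); rewrite le_max => /orP[H|H]; rewrite le_max.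
  by rewrite ler_pM2l// H.
by apply/orP; right; nra.
Qed.

Lemma run_fin_num k : reached k ->
  subproblem_obj b q c ceq (alpha k) (mu k) (x k) \is a fin_num.
Proof. by move=> /(run_x run); exact: dist_subproblem_fin. Qed.

(* Testing the conjugate at the fixed point -eta gives -b*(rho)/rho <= eta + b(-eta)/rho. *)
Lemma penalty_threshold_le : exists M : R, forall a mu', 0 < a / mu' -> M <= a / mu' ->
  (penalty_threshold m meq b P a mu' <= (eps_p P)%:E)%E.
Proof.
have ep := eps_p_gt0 Pok.
set N : R := (2 * (m + meq))%N%:R.
have N0 : 0 <= N by exact: ler0n.
have N1 : 0 < N + 1 by rewrite ltr_wpDl.
(* Once rho >= b(-eta) / eta, the bound eta + b(-eta) / rho is at most 2 eta, and N * 2 eta <=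
   eps_p; N + 1 allows N = 0. *)
pose eta := eps_p P / (N + 1) / 2.
have eta0 : 0 < eta by rewrite /eta !divr_gt0.
have Neta : - eta < 0 by rewrite oppr_lt0.
exists (fine (b (- eta)) / eta) => a mu'; set rho := a / mu' => rho0 Mrho.
rewrite /penalty_threshold ge_max lexx /=.
have econj_ge : (- econj b rho <= (rho * eta + fine (b (- eta)))%:E)%E.
  rewrite leeNl; apply: ereal_sup_ubound; exists (- eta) => //.
  by rewrite (barrierE bar Neta) -EFinN -EFinD /=; congr EFin; ring.
have rhoV0 : (0 <= (rho^-1)%:E)%E by rewrite lee_fin invr_ge0 ltW.
have step := lee_wpmul2r rhoV0 econj_ge.
apply: le_trans (lee_wpmul2l _ step) _; first by rewrite lee_fin.
rewrite -!EFinM lee_fin -/N.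
have H : (rho * eta + fine (b (- eta))) * rho^-1 <= 2 * eta.
  by rewrite ler_pdivrMr//; rewrite ler_pdivrMr// in Mrho; lra.
apply: le_trans (ler_wpM2l N0 H) _.
have etaE : 2 * eta * (N + 1) = eps_p P by rewrite /eta; field; rewrite gt_eqF.
by rewrite -etaE; nra.
Qed.

Section InfiniteRun.
Hypothesis nostop : forall k, ~ stops k.

Lemma all_reached k : reached k.
Proof. by move=> j _; exact: nostop. Qed.

Local Arguments all_reached : clear implicits.

Let alpha_gt0 k : 0 < alpha k := (run_gt0 (all_reached k)).1.
Let mu_gt0 k : 0 < mu k := (run_gt0 (all_reached k)).2.

(** Either alpha is multiplied by [delta_alpha] while mu does not increase, or alpha is unchanged
    and this alone forces mu to be multiplied by [delta_mu]. *)
Lemma ratio_growth : exists2 r, 1 < r & forall k, r * (alpha k / mu k) <= alpha k.+1 / mu k.+1.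
Proof.
have da := delta_alpha_gt1 Pok; have /andP[dm0 dm1] := delta_mu_itv Pok.
exists (Num.min (delta_alpha P) (delta_mu P)^-1).
  by rewrite lt_min da invf_gt1.
move=> k; have a0 := alpha_gt0 k; have m0 := mu_gt0 k; have rk := all_reached k.+1.
have r0 : 0 < alpha k / mu k by rewrite divr_gt0.
have [aE|aN] := eqVneq (alpha k.+1) (alpha k).
  rewrite (run_mu run rk) aE eqxx orbT invfM [leRHS]mulrCA ler_pM2r//.
  by rewrite ge_min lexx orbT.
have aE : alpha k.+1 = delta_alpha P * alpha k.
  by move: aN; rewrite (run_alpha run rk); case: ifP => // _; rewrite eqxx.
rewrite aE; apply: (@le_trans _ _ (delta_alpha P * (alpha k / mu k))).
  by rewrite ler_pM2r// ge_min lexx.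
rewrite -mulrA ler_pM2l ?(lt_trans ltr01)// ler_pM2l//.
by rewrite lef_pV2 ?posrE//; apply: mu_le.
Qed.

Lemma eventually_le_threshold : exists N, forall k, (N <= k)%N ->
  eps k <= eps_d P /\
  (penalty_threshold m meq b P (alpha k) (mu k) <= (eps_p P)%:E)%E.
Proof.
have [M HM] := penalty_threshold_le.
have [r r1 Hr] := ratio_growth.
have [N1 _ HN1] := @geometric_growth _ (fun k => alpha k / mu k) r M 0%N r1
  (divr_gt0 (alpha_gt0 _) (mu_gt0 _)) (fun k _ => Hr k).
have [N2 HN2] := geometric_small (epsilon0 P) (delta_eps_itv Pok) (eps_d_gt0 Pok).
exists (maxn N1 N2) => k; rewrite geq_max => /andP[k1 k2]; split.
  by apply: le_trans (eps_le (all_reached k)) _; rewrite ge_max lexx HN2.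
by apply: HM; [rewrite divr_gt0|exact: HN1].
Qed.

(* If mu were decreased infinitely often it would tend to 0 and the complementarity
   residual would fall below the tolerance; as the algorithm does not stop, the primal
   residual would exceed the threshold, so that alpha would increase at every step and mu
   would not be decreased any more. *)
Lemma eventually_mu_constant : exists K, forall k, (K <= k)%N ->
  [/\ s k <= eps_p P, eps_p P < p k, alpha k.+1 = delta_alpha P * alpha k &
      mu k.+1 = mu k].
Proof.
have [N HN] := eventually_le_threshold.
have da := delta_alpha_gt1 Pok; have /andP[dm0 dm1] := delta_mu_itv Pok.
have ep := eps_p_gt0 Pok.
pose dec k := (eps_p P < s k) || (alpha k.+1 == alpha k).
have Nep : - eps_p P < 0 by rewrite oppr_lt0.
have d0 := barrier_incr bar Nep.
suff [K HK] : exists K, forall k, (K <= k)%N -> ~~ dec k.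
  exists K => k /HK; rewrite /dec negb_or -leNgt => /andP[sk aN].
  have rk := all_reached k.+1; split=> //.
  - move: aN; rewrite (run_alpha run rk); case: ifP => [thr _|]; last by rewrite eqxx.
    by rewrite -lte_fin; apply: le_lt_trans thr; rewrite le_max lexx.
  - by move: aN; rewrite (run_alpha run rk); case: ifP => // _; rewrite eqxx.
  - by rewrite (run_mu run rk) ltNge sk (negbTE aN).
apply: contrapT => notK.
have decK K : exists2 k, (K <= k)%N & dec k.
  apply: contrapT => nd; apply: notK; exists K => k Kk; apply/negP => dk.
  by apply: nd; exists k.
have mu_small j : exists2 k, (N <= k)%N & mu k <= delta_mu P ^+ j * mu 0%N.
  elim: j => [|j [k Nk IH]].
    by exists N => //; rewrite expr0 mul1r mu_antimono// all_reached.
  have [k' kk' dk'] := decK k; exists k'.+1.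
    by rewrite (leq_trans Nk)// (leq_trans kk').
  rewrite (run_mu run (all_reached k'.+1)) (_ : (_ || _) = true)//.
  rewrite exprS -mulrA ler_pM2l//; apply: le_trans IH.
  exact: mu_antimono (all_reached _).
(* Below this value of mu, [sres_le] applies with e = eps_p. *)
have ep_d : 0 < eps_p P / (d (- eps_p P) * 2) by rewrite divr_gt0// mulr_gt0.
have [j Hj] := geometric_small (mu 0%N) (delta_mu_itv Pok) ep_d.
have [k Nk muk] := mu_small j.
have [k' kk' dk'] := decK k.
have muk' : mu k' <= eps_p P / (d (- eps_p P) * 2).
  apply: le_trans (Hj j (leqnn j)); apply: le_trans muk.
  exact: mu_antimono (all_reached _).
have sk' : s k' <= eps_p P.
  have Fk' := run_fin_num (all_reached k').
  apply: (sres_le bar (alpha_gt0 k') (mu_gt0 k') Fk' (x k')) => //.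
  rewrite ler_pdivlMr// in muk'; last by rewrite mulr_gt0.
  by rewrite mulr2n; lra.
have [epsk' thrk'] := HN k' (leq_trans Nk kk').
have pk' : eps_p P < p k'.
  by rewrite ltNge; apply/negP => pk'; apply: (@nostop k').
move: dk'; rewrite /dec ltNge sk' /= (run_alpha run (all_reached k'.+1)).
rewrite (le_lt_trans thrk') ?lte_fin//.
by rewrite gt_eqF// -subr_gt0 -[X in _ - X](mul1r (alpha k')) -mulrBl mulr_gt0// subr_gt0.
Qed.

Lemma alpha_cvg_pinfty : alpha @ \oo --> +oo.
Proof.
have [K HK] := eventually_mu_constant.
apply/cvgryPge => M.
have growth k : (K <= k)%N -> delta_alpha P * alpha k <= alpha k.+1.
  by move=> /HK[_ _ -> _].
have [N _ HN] := geometric_growth M (delta_alpha_gt1 Pok) (alpha_gt0 K) growth.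
by exists N.
Qed.

End InfiniteRun.

Lemma first_stop : (exists k, stops k) -> exists2 K, reached K & stops K.
Proof.
move=> [k sk]; have ex : exists k, `[< stops k >] by exists k; apply/asboolP.
case: (ex_minnP ex) => K /asboolP sK minK; exists K => // j jK sj.
have /minK : `[< stops j >] by apply/asboolP.
by rewrite leqNgt jK.
Qed.

(** As mu is nonincreasing, its minimum is attained at the stopping iteration or, in an infinite
    run, where it becomes constant. Attainment makes the infimum positive. *)
Lemma mu_bounded_below : exists2 K, reached K & forall k, reached k -> mu K <= mu k.
Proof.
have [/first_stop[K rK sK]|nostop] := pselect (exists k, stops k).
  exists K => // k rk; apply: mu_antimono => //.
  by rewrite leqNgt; apply/negP => Kk; exact: rk sK.
have {}nostop k : ~ stops k by move=> sk; apply: nostop; exists k.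
have [K HK] := eventually_mu_constant nostop.
have r k : reached k by exact: all_reached.
exists K => // k _; have [Kk|kK] := leqP K k; last by apply: mu_antimono; first exact: ltnW.
rewrite -(subnK Kk); elim: (k - K)%N => [|j IH] //.
by have [_ _ _ ->] := HK (j + K)%N (leq_addl _ _).
Qed.

End AlgorithmRun.

(** * Accumulation points of infinite runs *)

Section Sequences.
Variables (R : realType) (n : nat).
Implicit Types (u : nat -> 'rV[R]_n) (l p : 'rV[R]_n) (phi : nat -> nat).

Lemma cvg_natSinv u l : (forall j, `|l - u j| <= j.+1%:R^-1) -> u @ \oo --> l.
Proof.
move=> ul; apply/cvgrPdist_le => e e0; near=> j.
apply: le_trans (ul j) _; apply/ltW; near: j.
exact: (near_infty_natSinv_lt (PosNum e0)).
Unshelve. all: by end_near. Qed.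

Lemma cvg_ge_id phi : (forall j, (j <= phi j)%N) -> phi @ \oo --> \oo.
Proof.
move=> Hphi A [N _ NA]; exists N => // j /= Nj; apply: NA => /=.
exact: leq_trans (Hphi j).
Qed.

(** The condition j <= phi j replaces strict monotonicity: it makes phi tend to infinity and is
    preserved by composition. *)
Lemma cluster_subsequence u l : cluster (u @ \oo) l ->
  exists2 phi, (forall j, (j <= phi j)%N) & (u \o phi) @ \oo --> l.
Proof.
move=> ul.
have /choice[phi Hphi] j : exists k, (j <= k)%N /\ `|l - u k| <= j.+1%:R^-1.
  have j0 : 0 < j.+1%:R^-1 :> R by rewrite invr_gt0.
  have tail : (u @ \oo) [set u k | k in [set k | (j <= k)%N]].
    by exists j => // k jk; exists k.
  have /ul-/(_ _ tail) : nbhs l (ball l j.+1%:R^-1) by exact: nbhsx_ballx.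
  move=> /= [_ [[k jk <-]]]; rewrite mx_norm_ball /ball_ /= => lk.
  by exists k; split=> //; exact: ltW.
exists phi => [j|]; first by have [] := Hphi j.
by apply: cvg_natSinv => j; have [] := Hphi j.
Qed.

Lemma closed_sublevel (f : 'rV[R]_n -> R) (M : R) :
  continuous f -> closed [set y | f y <= M].
Proof.
move=> fc; exact: (@preimage_closed _ _ f [set t | t <= M] (fun y _ => fc y) (@closed_le R M)).
Qed.

Lemma bounded_subsequence u (M : R) : (forall k, `|u k| <= M) ->
  exists l phi, (forall j, (j <= phi j)%N) /\ (u \o phi) @ \oo --> l.
Proof.
move=> uM; pose K : set 'rV[R]_n := [set v | `|v| <= M].
have Kc : compact K.
  apply: bounded_closed_compact.
    exists M; split; first exact: num_real.
    by move=> M' MM' v /= /le_trans; apply; apply: ltW.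
  by apply: closed_sublevel; exact: norm_continuous.
have uK : (u @ \oo) K by exists 0%N => // k _; exact: uM.
have [l [_ /cluster_subsequence[phi phi_ge ul]]] := Kc _ _ uK.
by exists l, phi.
Qed.

End Sequences.

(** * Projections and regular normals of closed sets *)

Section NormalVectors.
Variables (R : realType) (n : nat).
Implicit Types (x y v w : 'rV[R]_n) (E : set 'rV[R]_n) (e : R).

Lemma projection_exists E p : closed E -> E !=set0 ->
  exists2 w, E w & forall y, E y -> dotv (p - w) (p - w) <= dotv (p - y) (p - y).
Proof.
move=> Ecl [x0 Ex0]; pose f y := dotv (p - y) (p - y).
have fc : continuous f.
  move=> y; apply: (sum_cvg (F := nbhs y)) => i.
  have idy : z @[z --> y] --> y by exact: cvg_id.
  have pyi : (p - z) 0 i @[z --> y] --> (p - y) 0 i.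
    exact: (rV_cvg_coord (cvgB (cvg_cst p) idy)).
  exact: (cvgM pyi pyi).
pose A := E `&` [set y | f y <= f x0].
have Acpt : compact A.
  apply: bounded_closed_compact.
    exists (`|p| + l2norm (p - x0)); split; first exact: num_real.
    move=> M MM y [_ fy]; apply: le_trans (ltW MM).
    rewrite -[y](subKr p); apply: le_trans (ler_normB _ _) _; rewrite lerD2l.
    apply: le_trans (norm_le_l2norm _) _; exact: ler_wsqrtr.
  apply: closedI => //.
  exact: closed_sublevel.
have A0 : A !=set0 by exists x0; split=> //=.
have [w] := EVT_min_rV A0 Acpt (continuous_subspaceT fc).
rewrite inE => -[Ew fw] wmin; exists w => // y Ey.
have [fy|fy] := leP (f y) (f x0); first by apply: wmin; rewrite inE.
exact: le_trans (ltW fy).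
Qed.

(** The condition f y = f x provides the convergence of values; for an indicator function it holds
    at all points of the set. *)
Lemma limiting_subdiff_approx (f : 'rV[R]_n -> \bar R) x v : f x \is a fin_num ->
  (forall e, 0 < e -> exists y w, [/\ regular_subdiff f y w, f y = f x,
    `|x - y| <= e & `|v - w| <= e]) ->
  limiting_subdiff f x v.
Proof.
move=> fx H; split=> //.
have j0 j : 0 < j.+1%:R^-1 :> R by rewrite invr_gt0.
have /choice[ys Hys] j : exists y, exists w, [/\ regular_subdiff f y w, f y = f x,
  `|x - y| <= j.+1%:R^-1 & `|v - w| <= j.+1%:R^-1] by exact: H.
have [ws Hws] := choice Hys; exists ys, ws; split.
- by apply: cvg_natSinv => j; have [] := Hws j.
- have -> : (fun k => f (ys k)) = (fun=> f x) by apply/funext => j; have [] := Hws j.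
  exact: cvg_cst.
- by apply: cvg_natSinv => j; have [] := Hws j.
- by move=> j; have [] := Hws j.
Qed.

Lemma regular_limiting_subdiff (f : 'rV[R]_n -> \bar R) x v :
  regular_subdiff f x v -> limiting_subdiff f x v.
Proof.
move=> fv; apply: limiting_subdiff_approx; first by case: fv.
by move=> e e0; exists x, v; rewrite !subrr normr0 ltW.
Qed.

Lemma indicator_funE E x : E x -> indicator_fun E x = 0%E.
Proof. by move=> Ex; rewrite /indicator_fun mem_set. Qed.

(* [u] is the proximal normal (x + eta v - w) / eta at the projection [w] of x + eta v
   on [E]: minimality of the distance and approximate normality of [v] give
   |x - w| <= 2 eta e. *)
Lemma regular_normal_near E x v e delta : closed E -> E x -> 0 < e -> 0 < delta ->
  (\forall y \near x, E y -> dotv v (y - x) <= e * `|y - x|) ->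
  exists w u, [/\ regular_subdiff (indicator_fun E) w u, E w,
    `|x - w| <= delta & `|v - u| <= 2 * e].
Proof.
move=> Ecl Ex e0 delta0 /nbhs_normP[r /= r0 Hr].
pose C := n%:R * `|v| + 1; have C0 : 0 < C by rewrite ltr_wpDl// mulr_ge0.
(* The crude estimate |x - w| <= 2 eta n |v| <= 2 eta C keeps w within delta and inside the ball
   where [Hr] can be tested at w; that test then yields the sharp bound. *)
pose eta := Num.min (r / 2) delta / (2 * C).
have rd0 : 0 < Num.min (r / 2) delta by rewrite lt_min delta0 divr_gt0.
have eta0 : 0 < eta by rewrite divr_gt0// mulr_gt0.
have etaE : eta * (2 * C) = Num.min (r / 2) delta by rewrite divfK// gt_eqF// mulr_gt0.
have [w Ew wmin] := projection_exists (x + eta *: v) Ecl (ex_intro _ x Ex).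
exists w, (eta^-1 *: (x + eta *: v - w)).
have xw2 : `|x - w| ^+ 2 <= 2 * eta * dotv v (w - x).
  apply: le_trans (sqr_norm_le_dotvv _) _.
  have := wmin x Ex; rewrite addrAC [x + eta *: v - x]addrAC subrr add0r -(opprB x w).
  move: (x - w) => h; rewrite dotvDl !dotvDr (dotvC v (- h)) dotvNl !(dotvZl, dotvC _ (eta *: v)).
  by rewrite (dotvC h v); lra.
have xw_small : `|x - w| <= Num.min (r / 2) delta.
  have [->|] := eqVneq (x - w) 0; first by rewrite normr0 ltW.
  rewrite -normr_gt0 => xw0; rewrite -(ler_pM2l xw0) -expr2; apply: le_trans xw2 _.
  have := le_trans (ler_norm _) (normr_dotv_le v (w - x)); rewrite -etaE /C distrC.
  move: (`|w - x|) (dotv v (w - x)) xw0; rewrite distrC => t s t0 st.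
  nra.
have [xwr xwd] : `|x - w| < r /\ `|x - w| <= delta.
  move: xw_small; rewrite le_min => /andP[A B]; split=> //.
  by apply: le_lt_trans A _; lra.
have xw_eta : `|x - w| <= eta * (2 * e).
  have [->|] := eqVneq (x - w) 0; first by rewrite normr0; nra.
  rewrite -normr_gt0 => xw0; rewrite -(ler_pM2l xw0) -expr2; apply: le_trans xw2 _.
  have := Hr w xwr Ew; rewrite distrC.
  move: (`|x - w|) (dotv v (w - x)) xw0 => t s t0 st; nra.
split=> //; last first.
  rewrite (_ : v - _ = - (eta^-1 *: (x - w))); last first.
    by rewrite addrAC scalerDr scalerA mulVf ?gt_eqF// scale1r opprD addrCA subrr addr0.
  by rewrite normrN normrZ gtr0_norm ?invr_gt0// ler_pdivrMl.
apply/regular_subdiffP; rewrite indicator_funE//; split=> // e' e'0.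
have n0 : 0 < n%:R + 1 :> R by rewrite ltr_wpDl.
(* With h = x + eta v - w, minimality gives 2 <h, y - w> <= n |y - w|^2, which within this radius is
   at most 2 eta e' |y - w|. *)
have rad : 0 < 2 * eta * e' / (n%:R + 1).
  by apply: divr_gt0 => //; apply: mulr_gt0 => //; apply: mulr_gt0.
near=> y; have [Ey|nEy] := pselect (E y); last first.
  by rewrite /indicator_fun memNset// leey.
rewrite indicator_funE// add0e lee_fin subr_le0 dotvZl ler_pdivrMl//.
have yw : `|y - w| <= 2 * eta * e' / (n%:R + 1).
  rewrite distrC; near: y.
  by apply: cvgr_dist_le; [exact: cvg_id|exact: rad].
have := wmin y Ey; rewrite (_ : x + eta *: v - y = (x + eta *: v - w) - (y - w)); last first.
  by rewrite opprB addrA subrK.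
have := le_trans (ler_norm _) (normr_dotv_le (y - w) (y - w)).
rewrite ler_pdivlMr// in yw.
have := normr_ge0 (y - w); move: yw.
move: (x + eta *: v - w) (y - w) => h z.
rewrite dotvBl !dotvBr (dotvC z h).
move: (`|z|) (dotv h z) (dotv h h) (dotv z z) => t hz hh zz yw t0 zzt H.
have : t * (t * (n%:R + 1)) <= t * (2 * eta * e') by apply: ler_wpM2l.
nra.
Unshelve. all: by end_near. Qed.

End NormalVectors.

(** * Subgradients of the infeasibility measure *)

Section Infeasibility.
Variables (R : realType) (n m meq : nat).
Variables (c : 'rV[R]_n -> 'rV[R]_m) (ceq : 'rV[R]_n -> 'rV[R]_meq).
Hypotheses (c_C1 : C1 c) (ceq_C1 : C1 ceq).

Lemma pos_part_subgradient (t s y : R) : 0 <= y <= 1 ->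
  (0 < t -> y = 1) -> (t < 0 -> y = 0) ->
  pos_part t + y * (s - t) <= pos_part s.
Proof.
move=> /andP[y0 y1] yp yn; rewrite /pos_part.
have A : s <= Num.max 0 s by rewrite le_max lexx orbT.
have A0 : 0 <= Num.max 0 s by rewrite le_max lexx.
have [t0|t0|->] := ltgtP t 0.
- by rewrite (yn t0) mul0r addr0.
- by rewrite (yp t0) mul1r subrKC.
- rewrite subr0; nra.
Qed.

Lemma norm_subgradient (t s y : R) : -1 <= y <= 1 ->
  (0 < t -> y = 1) -> (t < 0 -> y = -1) -> `|t| + y * (s - t) <= `|s|.
Proof.
move=> /andP[y0 y1] yp yn; have A := ler_norm s; have B := ler_norm (- s).
rewrite normrN in B; have [t0|t0|->] := ltgtP t 0.
- by rewrite ltr0_norm// (yn t0); lra.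
- by rewrite gtr0_norm// (yp t0); lra.
- rewrite normr0 subr0; nra.
Qed.

Lemma infeasibilityE z : infeasibility c ceq z =
  (\sum_i pos_part (c z 0 i) + \sum_j `|ceq z 0 j|)%:E.
Proof.
congr (_ + _)%:E; apply: eq_bigr => i _.
by rewrite mxE ger0_norm// le_max lexx.
Qed.

(** With the multipliers frozen, the linear combination of the constraints is smooth and its
    increments from [x] bound those of the infeasibility from below. Its gradient is therefore a
    regular subgradient. *)
Lemma infeasibility_subgradient x (y : 'rV[R]_m) (yeq : 'rV[R]_meq) :
  (forall i, [/\ 0 <= y 0 i <= 1, 0 < c x 0 i -> y 0 i = 1 & c x 0 i < 0 -> y 0 i = 0]) ->
  (forall j, [/\ -1 <= yeq 0 j <= 1, 0 < ceq x 0 j -> yeq 0 j = 1 &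
     ceq x 0 j < 0 -> yeq 0 j = -1]) ->
  regular_subdiff (infeasibility c ceq) x (JacT c x y + JacT ceq x yeq).
Proof.
move=> Hy Hyeq; apply/regular_subdiffP; split=> // e e0.
pose g z := \sum_i y 0 i * c z 0 i + \sum_j yeq 0 j * ceq z 0 j.
have gG : has_grad g x (JacT c x y + JacT ceq x yeq).
  rewrite !JacT_sum; apply: has_gradD; apply: has_grad_sum => i; apply: has_gradZ.
    by apply: differentiable_has_grad; exact: c_C1.1.
  by apply: differentiable_has_grad; exact: ceq_C1.1.
apply: filterS (gG _ e0) => z; rewrite distrC => /(le_trans (ler_norm _)) H.
rewrite !infeasibilityE -EFinD lee_fin.
have A : \sum_i pos_part (c x 0 i) + (\sum_i y 0 i * c z 0 i - \sum_i y 0 i * c x 0 i)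
    <= \sum_i pos_part (c z 0 i).
  rewrite -sumrB -big_split; apply: ler_sum => i _; rewrite -mulrBr.
  by have [? ? ?] := Hy i; apply: pos_part_subgradient.
have B : \sum_i `|ceq x 0 i| + (\sum_i yeq 0 i * ceq z 0 i - \sum_i yeq 0 i * ceq x 0 i)
    <= \sum_i `|ceq z 0 i|.
  rewrite -sumrB -big_split; apply: ler_sum => i _; rewrite -mulrBr.
  by have [? ? ?] := Hyeq i; apply: norm_subgradient.
rewrite /g in H; lra.
Qed.

End Infeasibility.

(** * Scaled multipliers along an infinite run *)

Section InfiniteRun.
Variables (R : realType) (n m meq : nat).
Variables (b : R -> \bar R) (q : 'rV[R]_n -> \bar R)
  (c : 'rV[R]_n -> 'rV[R]_m) (ceq : 'rV[R]_n -> 'rV[R]_meq).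
Variables (P : algo_params R) (x : nat -> 'rV[R]_n) (alpha mu eps : nat -> R).
Hypotheses (bar : barrier b) (c_C1 : C1 c) (ceq_C1 : C1 ceq)
  (Pok : algo_params_ok P) (run : algo_run b q c ceq P x alpha mu eps)
  (nostop : forall k, ~ stops b c ceq P x alpha mu eps k).

Local Notation d := (derive1 (fine \o b)).
Local Notation F k := (subproblem_obj b q c ceq (alpha k) (mu k)).

(** The point [z] is independent of the iterate, since regular subgradients are available only at
    points near [x k]. *)
Definition scaled_mult k (z : 'rV[R]_n) : 'rV[R]_m :=
  \row_i (mult b c (alpha k) (mu k) z i / alpha k).
Definition scaled_multeq k (z : 'rV[R]_n) : 'rV[R]_meq :=
  \row_j (multeq b ceq (alpha k) (mu k) z j / alpha k).

Let reach k : reached b c ceq P x alpha mu eps k := all_reached nostop (k := k).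
Let alpha_gt0 k : 0 < alpha k := (run_gt0 Pok run (@reach k)).1.
Let mu_gt0 k : 0 < mu k := (run_gt0 Pok run (@reach k)).2.
Let F_fin k : F k (x k) \is a fin_num := run_fin_num run (@reach k).

Lemma penalty_grad_scaled k z : penalty_grad b c ceq (alpha k) (mu k) z =
  alpha k *: (JacT c z (scaled_mult k z) + JacT ceq z (scaled_multeq k z)).
Proof.
rewrite /penalty_grad /JacT scalerDr !scalemxAl; congr (_ + _); congr (mulmx _ _);
  by apply/rowP => i; rewrite !mxE mulrC divfK// gt_eqF.
Qed.

(** Besides eps k <= epsilon0, the bound spends 1 on a distance that may not be attained and 1 on
    approximating a limiting subgradient by a regular one. *)
Lemma near_subgradient k : exists z w,
  [/\ regular_subdiff (F k) z w, `|x k - z| <= k.+1%:R^-1 & `|w| <= epsilon0 P + 2].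
Proof.
have [v [_ [xs [vs [xsx _ vsv rs]]]] v_small] := dist_le_ex (run_x run (@reach k)).
have k0 : 0 < k.+1%:R^-1 :> R by rewrite invr_gt0.
have : \forall j \near \oo, `|x k - xs j| <= k.+1%:R^-1 /\ `|v - vs j| <= 1.
  near=> j; split; near: j; [exact: cvgr_dist_le|exact: cvgr_dist_le].
move=> /filter_ex[j [xj vj]]; exists (xs j), (vs j); split=> //.
have epsk : eps k <= epsilon0 P.
  apply: le_trans (eps_le Pok run (@reach k)) _; rewrite ge_max (epsilon0_ge Pok) andbT.
  have /andP[de0 de1] := delta_eps_itv Pok; rewrite ger_pMl ?exprn_ile1 ?ltW//.
  exact: lt_le_trans (eps_d_gt0 Pok) (epsilon0_ge Pok).
have v_le : `|v| <= eps k + 1.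
  by apply: le_trans (norm_le_l2norm _) _; rewrite -l2normN -sub0r ltW.
rewrite -(subKr v (vs j)); apply: le_trans (ler_normB _ _) _; lra.
Unshelve. all: by end_near. Qed.

Lemma scaled_mult_bounds k z i : 0 <= scaled_mult k z 0 i <= 1.
Proof.
have [y0 ya _ _] := mult_bounds bar (alpha_gt0 k) (mu_gt0 k) (F_fin k) z i.
by rewrite mxE ler_pdivlMr// mul0r y0 ler_pdivrMr// mul1r.
Qed.

Lemma scaled_multeq_bounds k z j : -1 <= scaled_multeq k z 0 j <= 1.
Proof.
have [/andP[y0 ya] _ _] := multeq_bounds bar (alpha_gt0 k) (mu_gt0 k) (F_fin k) z j.
by rewrite mxE ler_pdivlMr// mulN1r y0 ler_pdivrMr// mul1r.
Qed.

Section Accumulation.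
Variables (theta : nat -> nat) (z : nat -> 'rV[R]_n) (xbar : 'rV[R]_n).
Hypotheses (theta_ge : forall j, (j <= theta j)%N) (z_cvg : z @ \oo --> xbar).

Lemma alpha_subseq_cvg_pinfty : alpha (theta j) @[j --> \oo] --> +oo.
Proof.
exact: (cvg_comp theta alpha (cvg_ge_id theta_ge) (alpha_cvg_pinfty bar Pok run nostop)).
Qed.

Lemma inv_ratio_cvg0 : mu (theta j) / alpha (theta j) @[j --> \oo] --> 0.
Proof.
apply/cvgrPdist_le => e e0; near=> j.
rewrite sub0r normrN ger0_norm; last by rewrite divr_ge0 ?ltW.
have : mu (theta j) <= mu 0%N.
  by apply: (mu_antimono Pok run) => //; exact: reach.
move=> /le_trans; rewrite ler_pdivrMr//; apply.
rewrite mulrC -ler_pdivrMr//; near: j.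
by move/cvgryPge : alpha_subseq_cvg_pinfty; apply.
Unshelve. all: by end_near. Qed.

Lemma C1_seq_cvg k (f : 'rV[R]_n -> 'rV[R]_k) i : C1 f ->
  f (z j) 0 i @[j --> \oo] --> f xbar 0 i.
Proof. by move=> f1; exact: (cvg_comp z _ z_cvg (@C1_cvg_coord _ _ _ f xbar i f1)). Qed.

(** Near a violated constraint the multiplier equals alpha exactly. Near a strictly satisfied one
    its scaled value is eventually at most (mu / alpha) b'(c_i(xbar) / 2), which tends to 0. *)
Lemma scaled_mult_cvg (y : 'rV[R]_m) i :
  scaled_mult (theta j) (z j) @[j --> \oo] --> y ->
  [/\ 0 <= y 0 i <= 1, 0 < c xbar 0 i -> y 0 i = 1 & c xbar 0 i < 0 -> y 0 i = 0].
Proof.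
move=> zy; have yi : scaled_mult (theta j) (z j) 0 i @[j --> \oo] --> y 0 i.
  exact: rV_cvg_coord zy.
have ci := @C1_seq_cvg _ c i c_C1.
have ybounds : 0 <= y 0 i <= 1.
  apply/andP; split; [apply: cvgr_to_ge yi _|apply: cvgr_to_le yi _]; near=> j;
    by have /andP[] := scaled_mult_bounds (theta j) (z j) i.
move/andP: (ybounds) => [y0 y1]; split=> // [c_gt0|c_lt0].
  apply/eqP; rewrite eq_le y1; apply: cvgr_to_ge yi _; near=> j.
  have cj : 0 < c (z j) 0 i by near: j; exact: cvgr_gt ci _ c_gt0.
  have [_ _ /(_ (ltW cj)) multE _] :=
    mult_bounds bar (alpha_gt0 (theta j)) (mu_gt0 (theta j)) (F_fin (theta j)) (z j) i.
  by rewrite mxE multE divff// gt_eqF.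
have t0 : c xbar 0 i / 2 < 0 by lra.
have ct : c xbar 0 i < c xbar 0 i / 2 by lra.
apply/eqP; rewrite eq_le y0 andbT.
have bound0 : mu (theta j) / alpha (theta j) * d (c xbar 0 i / 2) @[j --> \oo] --> 0.
  by rewrite -[X in _ --> X](mul0r (d (c xbar 0 i / 2))); apply: cvgMl; exact: inv_ratio_cvg0.
apply: (ler_cvg_to yi bound0); near=> j.
have cj : c (z j) 0 i < c xbar 0 i / 2 by near: j; exact: cvgr_lt ci _ ct.
have [_ _ _ /(_ (lt_trans cj t0)) multE] :=
  mult_bounds bar (alpha_gt0 (theta j)) (mu_gt0 (theta j)) (F_fin (theta j)) (z j) i.
rewrite mxE [leRHS]mulrAC ler_pM2r ?invr_gt0//; apply: le_trans multE _.
by rewrite ler_pM2l//; apply: (barrier_derive_le bar _ t0); exact: ltW.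
Unshelve. all: by end_near. Qed.

(** Here the scaled multiplier is only shown to approach 1 or -1. Once the constraint value has
    passed half its limit, the doubled argument in [multeq_bounds] has passed the limit, so the gap
    is at most 2 (mu / alpha) b'(-|ceq_i(xbar)|). *)
Lemma scaled_multeq_cvg (y : 'rV[R]_meq) i :
  scaled_multeq (theta j) (z j) @[j --> \oo] --> y ->
  [/\ -1 <= y 0 i <= 1, 0 < ceq xbar 0 i -> y 0 i = 1 & ceq xbar 0 i < 0 -> y 0 i = -1].
Proof.
move=> zy; have yi : scaled_multeq (theta j) (z j) 0 i @[j --> \oo] --> y 0 i.
  exact: rV_cvg_coord zy.
have ci := @C1_seq_cvg _ ceq i ceq_C1.
have ybounds : -1 <= y 0 i <= 1.
  apply/andP; split; [apply: cvgr_to_ge yi _|apply: cvgr_to_le yi _]; near=> j;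
    by have /andP[] := scaled_multeq_bounds (theta j) (z j) i.
have bound0 (K : R) : mu (theta j) / alpha (theta j) * K @[j --> \oo] --> 0.
  by rewrite -[X in _ --> X](mul0r K); apply: cvgMl; exact: inv_ratio_cvg0.
move/andP: (ybounds) => [y0 y1]; split=> // [c_gt0|c_lt0].
- have ct : ceq xbar 0 i / 2 < ceq xbar 0 i by lra.
  have t0 : - ceq xbar 0 i < 0 by lra.
  apply/eqP; rewrite eq_le y1 /= -subr_le0.
  have yi1 : 1 - scaled_multeq (theta j) (z j) 0 i @[j --> \oo] --> 1 - y 0 i.
    exact: (cvgB (cvg_cst _) yi).
  apply: (ler_cvg_to yi1 (bound0 (d (- ceq xbar 0 i) *+ 2))); near=> j.
  have cj : ceq xbar 0 i / 2 < ceq (z j) 0 i by near: j; exact: cvgr_gt ci _ ct.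
  have cj0 : 0 < ceq (z j) 0 i by lra.
  have [_ _ /(_ cj0) multE] :=
    multeq_bounds bar (alpha_gt0 (theta j)) (mu_gt0 (theta j)) (F_fin (theta j)) (z j) i.
  rewrite mxE -[X in X - _](divff (lt0r_neq0 (alpha_gt0 (theta j)))) -mulrBl [leRHS]mulrAC.
  rewrite ler_pM2r ?invr_gt0//; apply: le_trans multE _.
  rewrite -mulrnAr ler_pM2l// ler_pMn2r//; apply: (barrier_derive_le bar _ t0).
  by rewrite mulr2n; lra.
- have ct : ceq xbar 0 i < ceq xbar 0 i / 2 by lra.
  apply/eqP; rewrite eq_le y0 andbT -subr_le0 opprK addrC.
  have yi1 : 1 + scaled_multeq (theta j) (z j) 0 i @[j --> \oo] --> 1 + y 0 i.
    exact: (cvgD (cvg_cst _) yi).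
  apply: (ler_cvg_to yi1 (bound0 (d (ceq xbar 0 i) *+ 2))); near=> j.
  have cj : ceq (z j) 0 i < ceq xbar 0 i / 2 by near: j; exact: cvgr_lt ci _ ct.
  have cj0 : ceq (z j) 0 i < 0 by lra.
  have [_ /(_ cj0) multE _] :=
    multeq_bounds bar (alpha_gt0 (theta j)) (mu_gt0 (theta j)) (F_fin (theta j)) (z j) i.
  rewrite mxE -[X in X + _](divff (lt0r_neq0 (alpha_gt0 (theta j)))) -mulrDl [leRHS]mulrAC.
  rewrite ler_pM2r ?invr_gt0//; apply: le_trans multE _.
  rewrite -mulrnAr ler_pM2l// ler_pMn2r//; apply: (barrier_derive_le bar _ c_lt0).
  by rewrite mulr2n; lra.
Unshelve. all: by end_near. Qed.

End Accumulation.
End InfiniteRun.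

Section LipschitzOnDomain.
Variables (R : realType) (n : nat) (q : 'rV[R]_n -> \bar R).
Hypothesis q_proper : proper_fun q.
Implicit Types (x y z v : 'rV[R]_n) (U : set 'rV[R]_n) (L : R).

Lemma edom_fin_num x : edom q x <-> q x \is a fin_num.
Proof.
rewrite fin_numElt q_proper.2 /=; split=> //.
Qed.

Lemma locally_lipschitz_bound x : locally_lipschitz_on_dom q -> edom q x ->
  exists U L, [/\ nbhs x U, 0 <= L & forall y z, U y -> U z -> edom q y -> edom q z ->
    `|fine (q y) - fine (q z)| <= L * `|y - z|].
Proof.
move=> qL /qL[U xU lip]; exists U.
have : \forall M \near +oo, 0 <= M /\ forall y z, U y -> U z -> edom q y -> edom q z ->
    `|fine (q y) - fine (q z)| <= M * `|y - z|.
  near=> M; split; first by near: M; exact: nbhs_pinfty_ge.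
  move=> y z Uy Uz qy qz; pose A := U `&` edom q.
  suff /(_ (y, z)) : A `*` A `<=` [set yz : 'rV[R]_n * 'rV[R]_n |
      `|fine (q yz.1) - fine (q yz.2)| <= M * `|yz.1 - yz.2|] by apply.
  by near: M; exact: lip.
by move=> /filter_ex[L [L0 HL]]; exists L.
Unshelve. all: by end_near. Qed.

(** The subgradient inequality with tolerance 1, combined with q(y) - q(z) <= L |y - z| on the
    domain, gives the constant L + 1. *)
Lemma scaled_subgradient_normal U L a z v : 0 < a ->
  (forall y z, U y -> U z -> edom q y -> edom q z ->
    `|fine (q y) - fine (q z)| <= L * `|y - z|) ->
  nbhs z U -> regular_subdiff q z v ->
  \forall y \near z, edom q y -> dotv (a^-1 *: v) (y - z) <= (L + 1) / a * `|y - z|.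
Proof.
move=> a0 lip zU /regular_subdiffP[qz qv].
near=> y => qy.
have Uy : U y by near: y.
have Uz : U z by exact: nbhs_singleton.
have : (q z + (dotv v (y - z) - 1 * `|y - z|)%:E <= q y)%E by near: y; exact: qv.
have qyf := (edom_fin_num y).1 qy.
rewrite -(fineK qz) -(fineK qyf) -EFinD lee_fin mul1r => H.
have H' := le_trans (ler_norm _) (lip y z Uy Uz qy ((edom_fin_num z).2 qz)).
rewrite dotvZl [leRHS]mulrAC [leRHS]mulrC ler_pM2l ?invr_gt0//; lra.
Unshelve. all: by end_near. Qed.

End LipschitzOnDomain.

(** * Stationarity of accumulation points for the feasibility problem *)

Section AccumulationPoints.
Variables (R : realType) (n m meq : nat).
Variables (b : R -> \bar R) (q : 'rV[R]_n -> \bar R)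
  (c : 'rV[R]_n -> 'rV[R]_m) (ceq : 'rV[R]_n -> 'rV[R]_meq).
Variables (P : algo_params R) (x : nat -> 'rV[R]_n) (alpha mu eps : nat -> R).

Lemma accumulation_KKT_feasibility (xbar : 'rV[R]_n) :
  barrier b -> C1 c -> C1 ceq -> algo_params_ok P ->
  algo_run b q c ceq P x alpha mu eps ->
  (forall k, ~ stops b c ceq P x alpha mu eps k) ->
  proper_fun q -> closed (edom q) -> locally_lipschitz_on_dom q ->
  cluster (x @ \oo) xbar -> KKT_feasibility_problem q c ceq xbar.
Proof.
move=> bar c_C1 ceq_C1 Pok run nostop q_proper dom_closed q_lip xbar_cluster.
have reach k : reached b c ceq P x alpha mu eps k by exact: all_reached.
have alpha_gt0 k : 0 < alpha k := (run_gt0 Pok run (@reach k)).1.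
have mu_gt0 k : 0 < mu k := (run_gt0 Pok run (@reach k)).2.
have /choice[z /choice[w zw]] := near_subgradient Pok run nostop.
have [phi phi_ge x_cvg] := cluster_subsequence xbar_cluster.
have z_cvg : z (phi j) @[j --> \oo] --> xbar.
  have zx : x (phi j) - z (phi j) @[j --> \oo] --> (0 : 'rV[R]_n).
    apply: cvg_natSinv => j; rewrite sub0r normrN.
    have [_ zxj _] := zw (phi j); apply: le_trans zxj _.
    by rewrite lef_pV2 ?posrE// ler_nat ltnS.
  rewrite (_ : (fun j => z (phi j)) = (fun j => x (phi j) - (x (phi j) - z (phi j)))); last first.
    by apply/funext => j; rewrite subKr.
  rewrite -[xbar]subr0; exact: (cvgB x_cvg zx).
pose sm k := scaled_mult b c alpha mu k (z k).
pose sme k := scaled_multeq b ceq alpha mu k (z k).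
have sm1 k : `|sm k| <= 1.
  apply: rV_norm_le => // i; rewrite ler_norml.
  have /andP[y0 y1] := scaled_mult_bounds bar Pok run nostop k (z k) i.
  by rewrite y1 andbT; apply: le_trans y0; rewrite oppr_le0.
have sme1 k : `|sme k| <= 1.
  apply: rV_norm_le => // i; rewrite ler_norml.
  exact: (scaled_multeq_bounds bar Pok run nostop k (z k) i).
have [y [phi1 [phi1_ge y_cvg]]] := bounded_subsequence (u := sm \o phi) (fun j => sm1 (phi j)).
have [yeq [phi2 [phi2_ge yeq_cvg]]] :=
  bounded_subsequence (u := sme \o phi \o phi1) (fun j => sme1 (phi (phi1 j))).
pose theta := phi \o phi1 \o phi2.
have theta_ge j : (j <= theta j)%N.
  by rewrite (leq_trans (phi2_ge j))// (leq_trans (phi1_ge _))//; exact: phi_ge.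
have zt_cvg : z (theta j) @[j --> \oo] --> xbar.
  exact: (cvg_comp phi2 _ (cvg_ge_id phi2_ge) (cvg_comp phi1 _ (cvg_ge_id phi1_ge) z_cvg)).
have yt_cvg : sm (theta j) @[j --> \oo] --> y.
  exact: (cvg_comp phi2 _ (cvg_ge_id phi2_ge) y_cvg).
have Hy i := scaled_mult_cvg bar c_C1 Pok run nostop theta_ge zt_cvg i yt_cvg.
have Hyeq i := scaled_multeq_cvg bar ceq_C1 Pok run nostop theta_ge zt_cvg i yeq_cvg.
pose u := JacT c xbar y + JacT ceq xbar yeq.
pose G k := JacT c (z k) (sm k) + JacT ceq (z k) (sme k).
have G_cvg : G (theta j) @[j --> \oo] --> u.
  exact: (cvgD (JacT_cvg c_C1.2 zt_cvg yt_cvg) (JacT_cvg ceq_C1.2 zt_cvg yeq_cvg)).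
have Fz_fin k : subproblem_obj b q c ceq (alpha k) (mu k) (z k) \is a fin_num.
  by have [[]] := zw k.
have z_dom k : edom q (z k).
  by apply/(edom_fin_num q_proper); have [] := subproblem_fin_num (mu_gt0 k) (Fz_fin k).
have xbar_dom : edom q xbar.
  by apply: (closed_cvg (edom q) dom_closed _ xbar zt_cvg); exists 0%N => // j _; exact: z_dom.
(* Divided by alpha, this subgradient differs from -G by w / alpha, which vanishes: hence the
   candidate normal -u. *)
have q_subgrad k : regular_subdiff q (z k) (w k - alpha k *: G k).
  rewrite -(penalty_grad_scaled Pok run nostop).
  apply: (regular_subdiff_subgrad (g := penalty b c ceq (alpha k) (mu k))).
    exact: (penalty_has_grad bar c_C1 ceq_C1 (alpha_gt0 k) (mu_gt0 k) (Fz_fin k)).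
  rewrite -(subproblem_objE bar (alpha_gt0 k) (mu_gt0 k) (Fz_fin k)).
  by have [] := zw k.
exists u; first exact/regular_limiting_subdiff/infeasibility_subgradient.
exists (- u); last by rewrite addrN.
apply: limiting_subdiff_approx => [|delta delta0]; first by rewrite indicator_funE.
have [U [L [xU L0 lip]]] := locally_lipschitz_bound q_lip xbar_dom.
have alphaV_cvg : (alpha (theta j))^-1 @[j --> \oo] --> 0.
  have alpha_infty := alpha_subseq_cvg_pinfty bar Pok run nostop theta_ge.
  apply/cvgrPdist_le => e e0; near=> j.
  rewrite sub0r normrN gtr0_norm ?invr_gt0// invf_ple ?posrE//.
  by near: j; move/cvgryPge : alpha_infty; apply.
(* The error in the normal is at most |u - G| + |w| / alpha + 2 (L + 1) / alpha <= delta/4 + 2 C /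
   alpha, and C / alpha <= delta/4 leaves it below delta. *)
pose C := epsilon0 P + 2 + (L + 1).
have C0 : 0 < C.
  have := lt_le_trans (eps_d_gt0 Pok) (epsilon0_ge Pok); rewrite /C; lra.
have dC : 0 < delta / 4 / C by rewrite !divr_gt0.
have : \forall j \near \oo, [/\ nbhs (z (theta j)) U, `|xbar - z (theta j)| <= delta / 2,
    `|u - G (theta j)| <= delta / 4 & (alpha (theta j))^-1 <= delta / 4 / C].
  near=> j; split; near: j.
  - exact: (zt_cvg _ (nbhs_interior xU)).
  - by apply: cvgr_dist_le zt_cvg _ _; lra.
  - by apply: cvgr_dist_le G_cvg _ _; lra.
  - by apply: cvgr_le alphaV_cvg _ _.
move=> /filter_ex[j []]; set k := theta j => zU xz uG aV.
have aV0 : 0 < (alpha k)^-1 by rewrite invr_gt0.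
have normal := scaled_subgradient_normal q_proper (alpha_gt0 k) lip zU (q_subgrad k).
have e0 : 0 < (L + 1) / alpha k by rewrite mulr_gt0//; lra.
have delta2 : 0 < delta / 2 by lra.
have [e [v [ev Ee ze vv]]] := regular_normal_near dom_closed (z_dom k) e0 delta2 normal.
exists e, v; split=> //.
- by rewrite !indicator_funE.
- by rewrite -(subrKA (z k)); apply: le_trans (ler_normD _ _) _; lra.
- set v0 := (alpha k)^-1 *: (w k - alpha k *: G k) in vv.
  have decomp (r s g h : 'rV[R]_n) (t : R) : t != 0 ->
      - r - s = - (r - g) - t^-1 *: h + (t^-1 *: (h - t *: g) - s).
    by move=> t0; apply/rowP => i; rewrite !mxE; field.
  rewrite (decomp _ _ (G k) (w k) (alpha k)) ?gt_eqF// -/v0.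
  have [_ _ wk] := zw k.
  apply: le_trans (ler_normD _ _) _; apply: le_trans (lerD (ler_normB _ _) (lexx _)) _.
  rewrite normrN normrZ (gtr0_norm aV0).
  have : (alpha k)^-1 * C <= delta / 4 by rewrite -ler_pdivlMr.
  have : (alpha k)^-1 * `|w k| <= (alpha k)^-1 * (epsilon0 P + 2) by rewrite ler_pM2l.
  have : 0 <= (alpha k)^-1 * (epsilon0 P + 2).
    rewrite mulr_ge0 ?(ltW aV0)//; have := lt_le_trans (eps_d_gt0 Pok) (epsilon0_ge Pok); lra.
  move: vv uG aV0; rewrite /C; move: (alpha k)^-1 => a' vv uG aV0; nra.
Unshelve. all: by end_near. Qed.
End AccumulationPoints.

(** * Positivity of the barrier parameter and the two scenarios *)

Theorem corollary4p9 (R : realType) (n m meq : nat)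
    (q : 'rV[R]_n -> \bar R)
    (c : 'rV[R]_n -> 'rV[R]_m) (ceq : 'rV[R]_n -> 'rV[R]_meq)
    (b : R -> \bar R) (P : algo_params R)
    (x : nat -> 'rV[R]_n) (alpha mu eps : nat -> R) :
  proper_fun q -> lower_semicontinuous q ->
  C1 c -> C1 ceq ->
  ereal_inf [set q z | z in feasible c ceq] \is a fin_num ->
  barrier b ->
  algo_params_ok P ->
  algo_run b q c ceq P x alpha mu eps ->
  closed (edom q) -> locally_lipschitz_on_dom q ->
  let A := returns_KKT b q c ceq P x alpha mu eps in
  let B := runs_indefinitely_infeasible b q c ceq P x alpha mu eps in
  0 < inf [set mu k | k in reached b c ceq P x alpha mu eps] /\
  ((A /\ ~ B) \/ (B /\ ~ A)).
Proof.
move=> q_proper _ c_C1 ceq_C1 _ bar Pok run dom_closed q_lip A B; split.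
  have [K rK muK] := mu_bounded_below bar Pok run.
  apply: lt_le_trans (run_gt0 Pok run rK).2 _.
  (* Nonemptiness has to be shown because [inf] of the empty set is 0 by convention. *)
  apply: lb_le_inf; first by exists (mu K), K.
  by move=> _ [k rk <-]; exact: muK.
(* The scenarios exclude each other because A exhibits a stopping iteration and B denies that there
   is one. *)
have [/first_stop[K rK sK]|nostop] :=
    pselect (exists k, stops b c ceq P x alpha mu eps k).
  left; split; last by case=> /(_ K).
  exists K; split=> //; have [a0 mu0] := run_gt0 Pok run rK.
  have [epsK pK sresK] := sK.
  apply: (stationary_KKT bar c_C1 ceq_C1 a0 mu0 _ pK sresK).
  by apply: le_trans (run_x run rK) _; rewrite lee_fin.
have {}nostop k : ~ stops b c ceq P x alpha mu eps k by move=> sk; apply: nostop; exists k.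
right; split; last by case=> k [_ /nostop].
split=> //.
- have [K HK] := eventually_mu_constant bar Pok run nostop.
  by exists K => // k /HK[-> ->].
- split; last exact: alpha_cvg_pinfty Pok run nostop.
  by apply/nondecreasing_seqP => k; apply: alpha_le Pok run _ _; exact: all_reached.
- move=> xbar.
  exact: (accumulation_KKT_feasibility bar c_C1 ceq_C1 Pok run nostop q_proper dom_closed
    q_lip).
Qed.
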